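(* Let $1<q<\infty$, $q<p<\infty$, $r=p/q$, $1/r+1/r'=1$. Let $\mathcal L,\mu,\nu$ be as in the context, let $\beta=\{\beta_{I,I'}\}_{I\in\mathcal L,\,I'\in\operatorname{ch}(I)}$ be an arbitrary numerical sequence, let $\Pi_\beta$ be the corresponding generalized vector paraproduct, and let $b_I=\sum_{I'\in\operatorname{ch}(I)}\beta_{I,I'}\mathbf 1_{I'}$ for $I\in\mathcal L$. There is a finite constant $A$ such that $$\|\Pi_\beta f\|_{\dot{\mathbf g}_p^q(\nu)}^p\le A^p\|f\|_{L^p(\mu)}^p\qquad\text{for all } f\in L^p(\mu)$$ if and only if there are finite constants $B$, $B_*$ such that for all $J\in\mathcal L$ both $$\int_J\Bigl(\sum_{I\in\mathcal L(J)}|b_I|^q\Bigr)^{p/q}d\nu\le B^p\mu(J)$$ and $$\int_J\Bigl[\sum_{I\in\mathcal L(J)}\frac{\nu(I)}{\mu(I)}\,\mathbb E_I^\nu\bigl(|b_I|^q\bigr)\Bigr]^{r'}d\mu\le B_*^{r'}\nu(J)$$ hold. Moreover, the best constants satisfy $\max\{B,c(p,q)B_*^{1/q}\}\le A\le C(p,q)\max\{B,B_*^{1/q}\}$, where $0<c(p,q)$ and $C(p,q)<\infty$ depend only on $p$ and $q$.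
   Context: Setup. $(\mathcal X,\mathfrak S)$ is a measurable space carrying a $\sigma$-finite measure $\mu$ and a filtration, i.e. an increasing sequence of $\sigma$-algebras $\mathfrak S_n\subset\mathfrak S_{n+1}\subset\mathfrak S$, $n\in\mathbb Z$. Each $\mathfrak S_n$ is atomic: there is a countable collection $\mathcal L_n$ of disjoint sets of finite measure (atoms, also called intervals) such that each $A\in\mathfrak S_n$ is a union of sets from $\mathcal L_n$; thus each $I\in\mathcal L_n$ is an at most countable union of elements of $\mathcal L_{n+1}$. Put $\mathcal L=\bigcup_{n\in\mathbb Z}\mathcal L_n$. An atom may belong to several, even infinitely many, $\mathcal L_n$, but not to all of them. $\mu,\nu$ are measures on $(\mathcal X,\mathfrak S)$ that are locally finite, i.e. finite on every $I\in\mathcal L$. For $I\in\mathcal L$, $\operatorname{rk} I=\sup\{n: I\in\mathcal L_n\}\in\mathbb Z\cup\{+\infty\}$. If $\operatorname{rk} I=n<\infty$, the children of $I$ are $\operatorname{ch}(I)=\{I'\in\mathcal L_{n+1}: I'\subset I\}$; if $\operatorname{rk} I=\infty$, $\operatorname{ch}(I)=\{I\}$. For $J\in\mathcal L$, $\mathcal L(J)=\{I\in\mathcal L: I\subset J\}$. For a locally finite measure $\sigma$, $\langle f\rangle_{I,\sigma}=\sigma(I)^{-1}\int_I f\,d\sigma$ (and $\langle f\rangle_{I,\sigma}=0$ if $\sigma(I)=0$), and $\mathbb E_I^\sigma f=\langle f\rangle_{I,\sigma}\mathbf 1_I$. In integrals with respect to $\mu$, terms containing $\frac{\nu(I)}{\mu(I)}\mathbb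 E_I^\nu(\cdot)$ with $\mu(I)=0$ are read as $0$ (they are supported on a $\mu$-null set). The generalized vector paraproduct $\Pi_\beta$ maps $f\in L^p(\mu)$ to the sequence $\Pi_\beta f=\{\langle f\rangle_{I,\mu}\beta_{I,I'}\}$ indexed by pairs $(I,I')$ with $I\in\mathcal L$, $I'\in\operatorname{ch}(I)$ (parent $I$, child $I'$). The norm in the Triebel–Lizorkin type sequence space $\dot{\mathbf g}_p^q(\nu)=\dot{\mathbf g}_p^q(\mathcal L,\nu)$ of a sequence $s=\{s_{I,I'}\}$ is $\|s\|_{\dot{\mathbf g}_p^q(\nu)}=\bigl\|\bigl(\sum_{I}\sum_{I'\in\operatorname{ch}(I)}|s_{I,I'}|^q\mathbf 1_{I'}\bigr)^{1/q}\bigr\|_{L^p(\nu)}$. Thus $$\|\Pi_\beta f\|_{\dot{\mathbf g}_p^q(\nu)}^p=\int_{\mathcal X}\Bigl(\sum_{I\in\mathcal L}|\langle f\rangle_{I,\mu}|^q|b_I|^q\Bigr)^{p/q}d\nu .$$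
   Formalization: The formal theorem additionally assumes β_{I,I'} = 0 whenever μ(I) = 0 and ν(I') > 0; without this, Π_β ignores such coefficients (as ⟨f⟩_{I,μ} = 0) while the first testing condition fails, so the stated equivalence is false. *)

(* Defs.v *)
From HB Require Import structures.
From mathcomp Require Import all_boot all_order all_algebra.
From mathcomp Require Import all_classical all_reals all_analysis.
Import Order.TTheory GRing.Theory Num.Theory.
Import numFieldNormedType.Exports.

Set Implicit Arguments.
Unset Strict Implicit.
Unset Printing Implicit Defensive.

Local Open Scope classical_set_scope.
Local Open Scope ring_scope.
Local Open Scope ereal_scope.

Definition intervals {T : Type} (L : int -> set (set T)) : set (set T) :=
  \bigcup_n L n.

Definition intervals_in {T : Type} (L : int -> set (set T)) (J : set T) :
  set (set T) := [set I | intervals L I /\ I `<=` J].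

(* [S n] is the n-th sigma-algebra and [L n] its collection of atoms.  The
   finiteness of the measure of the atoms is [locally_finite] below. *)
Record atomic_filtration (d : measure_display) (T : measurableType d)
    (S L : int -> set (set T)) : Prop := AtomicFiltration {
  filtration_sigma_algebra : forall n, sigma_algebra [set: T] (S n) ;
  filtration_measurable : forall n, S n `<=` measurable ;
  filtration_increasing : forall n, S n `<=` S (n + 1)%R ;
  atoms_in_filtration : forall n, L n `<=` S n ;
  atoms_nonempty : forall n I, L n I -> I !=set0 ;
  atoms_countable : forall n, countable (L n) ;
  atoms_disjoint : forall n, trivIset (L n) id ;
  atoms_generate : forall n A, S n A ->
    exists2 F : set (set T), F `<=` L n & A = \bigcup_(I in F) I ;
  atoms_not_everywhere : forall I, intervals L I -> exists n, ~ L n I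
}.

Definition locally_finite (d : measure_display) (T : measurableType d)
    (R : realType) (L : int -> set (set T)) (sigma : {measure set T -> \bar R}) :=
  forall I, intervals L I -> sigma I < +oo.

(* Takes its values in Z or {+oo} when [I] belongs to some [L n]. *)
Definition rk (R : realType) {T : Type} (L : int -> set (set T)) (I : set T) :
  \bar R := ereal_sup [set (n%:~R)%:E | n in [set n : int | L n I]].

Definition ch (R : realType) {T : Type} (L : int -> set (set T)) (I : set T) :
    set (set T) :=
  [set I' | (rk R L I = +oo /\ I' = I) \/
    exists n : int, [/\ rk R L I = (n%:~R)%:E, L (n + 1)%R I' & I' `<=` I]].

(* Extended-real valued, since it is also applied to nonnegative functions
   whose integral may be infinite.  If [sigma I = 0], then it is 0, because
   [0^-1 = 0] in [R]. *)
Definition avg (d : measure_display) (T : measurableType d) (R : realType)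
    (sigma : {measure set T -> \bar R}) (I : set T) (f : T -> \bar R) : \bar R :=
  ((fine (sigma I))^-1)%:E * \int[sigma]_(x in I) f x.

Definition cond_exp (d : measure_display) (T : measurableType d) (R : realType)
    (sigma : {measure set T -> \bar R}) (I : set T) (f : T -> \bar R) :
  T -> \bar R := fun x => avg sigma I f * (\1_I x)%:E.

Definition paraproduct (d : measure_display) (T : measurableType d)
    (R : realType) (mu : {measure set T -> \bar R})
    (beta : set T -> set T -> R) (f : T -> R) : set T -> set T -> R :=
  fun I I' => (fine (avg mu I (EFin \o f)) * beta I I')%R.

Definition seq_norm (d : measure_display) (T : measurableType d)
    (R : realType) (nu : {measure set T -> \bar R}) (L : int -> set (set T))
    (p q : R) (s : set T -> set T -> R) : \bar R :=
  'N[nu]_(p%:E)[(fun x =>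
    (\esum_(I in intervals L) \esum_(I' in ch R L I)
       (`|s I I'| `^ q * \1_I' x)%:E) `^ q^-1)].

(* The children of [I] are disjoint, so that the sum has at most one nonzero
   term at each point. *)
Definition bfun {T : choiceType} (R : realType) (L : int -> set (set T))
    (beta : set T -> set T -> R) (I : set T) : T -> R :=
  fun x => (\sum_(I' \in ch R L I) beta I I' * \1_I' x)%R.

Definition paraproduct_bound (d : measure_display) (T : measurableType d)
    (R : realType) (mu nu : {measure set T -> \bar R})
    (L : int -> set (set T)) (beta : set T -> set T -> R) (p q A : R) : Prop :=
  forall f : T -> R, f \in Lfun mu p%:E ->
    seq_norm nu L p q (paraproduct mu beta f) `^ p
      <= (A `^ p)%:E * 'N[mu]_(p%:E)[EFin \o f] `^ p.

Definition direct_testing (d : measure_display) (T : measurableType d)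
    (R : realType) (mu nu : {measure set T -> \bar R})
    (L : int -> set (set T)) (beta : set T -> set T -> R) (p q B : R) : Prop :=
  forall J, intervals L J ->
    \int[nu]_(x in J) (\esum_(I in intervals_in L J)
       (`|bfun L beta I x| `^ q)%:E) `^ (p / q)
      <= (B `^ p)%:E * mu J.

(* The real quotient [nu I / mu I] is 0 if [mu I = 0], and [0 * +oo = 0]. *)
Definition dual_testing (d : measure_display) (T : measurableType d)
    (R : realType) (mu nu : {measure set T -> \bar R})
    (L : int -> set (set T)) (beta : set T -> set T -> R) (q r' Bs : R) : Prop :=
  forall J, intervals L J ->
    \int[mu]_(x in J) (\esum_(I in intervals_in L J)
       ((fine (nu I) / fine (mu I))%:E *
        cond_exp nu I (fun y => (`|bfun L beta I y| `^ q)%:E) x)) `^ r'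
      <= (Bs `^ r')%:E * nu J.

(* Nonnegativity matters: [a `^ p = 1] for every [a < 0].  The value is +oo
   if no constant is admissible. *)
Definition best_constant (R : realType) (P : R -> Prop) : \bar R :=
  ereal_inf [set a%:E | a in [set a : R | (0 <= a)%R /\ P a]].

(* If [mu I = 0], then [paraproduct mu beta] does not involve [beta I I'],
   whereas [direct_testing] for [J = I] forces [beta I I' = 0] for every child
   [I'] with [nu I' != 0].  So this condition follows from [direct_testing],
   and the boundedness of the paraproduct does not imply [direct_testing]
   without it. *)
Definition no_invisible_coefficient (d : measure_display) (T : measurableType d)
    (R : realType) (mu nu : {measure set T -> \bar R})
    (L : int -> set (set T)) (beta : set T -> set T -> R) : Prop :=
  forall I I', intervals L I -> ch R L I I' ->
    mu I = 0 -> nu I' != 0 -> beta I I' = 0%R.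

(* Main.v *)
Require Import Defs.
From HB Require Import structures.
From mathcomp Require Import all_boot all_order all_algebra.
From mathcomp Require Import all_classical all_reals all_analysis.
From mathcomp Require Import measurable_realfun zify lra ring.
Import Order.TTheory GRing.Theory Num.Theory.
Import numFieldNormedType.Exports.

Set Implicit Arguments.
Unset Strict Implicit.
Unset Printing Implicit Defensive.

Local Open Scope classical_set_scope.
Local Open Scope ring_scope.

(** Let [r = p / q].  By Jensen's inequality the [q]-th power of the average of
    [f] over [I] is at most the average of [h = `|f| ^ q] (lemma
    [jensen_aver]), and [h] lies in [L^r(mu)] exactly when [f] lies in
    [L^p(mu)].  So the paraproduct is dominated by the positive linear operator
    that maps [h] to the sum, over all pairs (parent [I], child [I']), of
    [<h>_I `|beta I I'| ^ q 1_I'], and the two testing conditions are the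
    Sawyer conditions for this operator, from [L^r(mu)] to [L^r(nu)], and for
    its adjoint.

    Sufficiency.  By monotone convergence only finitely many pairs matter.
    Pair the operator with [g] in [L^r'(nu)] and run stopping times for [h] and
    for [g] in parallel: every parent [I] is assigned a stopping interval [F]
    that contains it and over which the [mu]-average of [h] is at least [1 / e]
    times the one over [I], and every child [I'] a stopping interval [G], in the
    same way, for the [nu]-averages of [g].  Both contain [I'], so
    they are nested.  If [F] is contained in [G], then so is [I], and the pair
    is charged to the dual testing condition on [G]; otherwise [G] is strictly
    smaller than [F], and the pair is charged to the direct testing condition on
    [F].  In both cases the average over the larger interval is a constant,
    the other average is bounded by a maximal function built from the smaller
    stopping intervals only, and Young's inequality separates the two
    ([one_sided_testing_bound]).  The sum converges because each smaller
    stopping interval is attached to a single larger one: for [F] inside [G]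
    this is the definition of stopping, and for [G] inside [F] it holds because
    no interval lies strictly between a child and its parent ([bilinear_le]).
    What is left is two Carleson sums.  Along a chain of stopping intervals the
    averages grow geometrically, and this gives the Carleson embedding
    ([carleson_embedding]).  The choice of [g] as a small multiple of the
    [r-1]-st power of the image of [h] turns the bilinear estimate into the norm
    estimate ([strong_estimate]).

    Necessity.  The direct condition is the case [f = 1_J].  For the dual
    condition on [J], let [Lambda] be a finite part of the sum in the bracket
    and let [h] be its [r'-1]-st power; the [q]-th root [f] of the maximal
    function of [h] satisfies [<f>_I ^ q >= <h>_I], while Doob's inequality
    bounds the [p]-th moment of [f] by a multiple of the [r]-th moment of [h],
    that is, of the [r']-th moment of [Lambda], which is finite and can be
    absorbed ([dual_necessity]).

    Hoelder's inequality is replaced throughout by Young's inequality with a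
    parameter followed by absorption.  This is legitimate because every
    quantity that is absorbed comes from a finite family and is finite. *)

(** * Stopping intervals in a finite laminar family *)

Section Stopping.
Variables (R : realType) (T : Type) (X : finType) (S : X -> set T).
Hypothesis S_inj : injective S.
Hypothesis S_ne : forall x, S x !=set0.
Hypothesis S_lam : forall x y t, S x t -> S y t ->
  S x `<=` S y \/ S y `<=` S x.

(** The interval [stop x] is the largest one above [x] at which the maximum of
    [v] over all intervals above [x] is attained.  This describes the result of
    a stopping-time construction without recursion on generations. *)
Definition stopping_map (v : X -> R) (stop : X -> X) := forall x,
  [/\ S x `<=` S (stop x), forall z, S x `<=` S z -> v z <= v (stop x) &
      forall z, S x `<=` S z -> v z = v (stop x) -> S z `<=` S (stop x)].

(** The intervals above [x] form a chain, because they share a point; among those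
    that maximize [v], the one with the most intervals below it is the
    largest. *)
Lemma stopping_map_exists (v : X -> R) : exists stop, stopping_map v stop.
Proof.
suff H x : exists y, [/\ S x `<=` S y, forall z, S x `<=` S z -> v z <= v y &
    forall z, S x `<=` S z -> v z = v y -> S z `<=` S y].
  by have [stop stopP] := choice H; exists stop.
pose le y z := `[< S y `<=` S z >].
have leP y z : reflect (S y `<=` S z) (le y z) by exact: asboolP.
have lexx : le x x by apply/leP.
case: (@Order.TotalTheory.arg_maxP _ _ _ x (le x) v lexx) => y0 ly0 maxy0.
have Py0 : le x y0 && (v y0 == v y0) by rewrite ly0 eqxx.
case: (@arg_maxnP _ y0 (fun y => le x y && (v y == v y0))
  (fun y => #|[set z | le z y]%SET|) Py0) => y /andP[ly /eqP vy] maxy.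
exists y; split; first exact/leP.
  by move=> z /leP lz; rewrite vy; exact: maxy0.
move=> z lz vz; have [t xt] := S_ne x.
have [//|yz] := S_lam (lz _ xt) ((leP _ _ ly) _ xt).
have cle : (#|[set u | le u z]%SET| <= #|[set u | le u y]%SET|)%N.
  by apply: maxy; rewrite -vy vz eqxx andbT; exact/leP.
have sub : [set u | le u y]%SET \subset [set u | le u z]%SET.
  apply/fintype.subsetP => u; rewrite !inE => uy w uw.
  exact/yz/uy.
have /eqP e : [set u | le u y]%SET == [set u | le u z]%SET.
  by rewrite eqEcard sub.
have zz : z \in [set u | le u z]%SET by rewrite inE; exact/leP.
by move: zz; rewrite -e inE => /leP.
Qed.

Variables (v : X -> R) (stop : X -> X).
Hypothesis stopP : stopping_map v stop.

Lemma stop_sub x : S x `<=` S (stop x). Proof. by have [] := stopP x. Qed.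

Lemma stop_ge x : v x <= v (stop x).
Proof. by have [_ + _] := stopP x; apply. Qed.

(** The stopping interval of [x] is also that of every interval between [x] and
    it.  This is what makes the assignment of smaller to larger stopping
    intervals single-valued. *)
Lemma stop_between x y : S x `<=` S y -> S y `<=` S (stop x) -> stop y = stop x.
Proof.
move=> xy ypx; have [xpx gex mx] := stopP x; have [ypy gey my] := stopP y.
have e : v (stop y) = v (stop x).
  by apply/eqP; rewrite eq_le gey ?gex// => w xw; exact/ypy/xy.
apply: S_inj; apply/seteqP; split; last by apply: my.
by apply: mx => // w xw; exact/ypy/xy.
Qed.

Lemma stop_idem x : stop (stop x) = stop x.
Proof. by apply: stop_between; [exact: stop_sub|]. Qed.

Lemma stop_strict F F' : stop F = F -> S F `<=` S F' -> F <> F' -> v F' < v F.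
Proof.
move=> pF FF' nF; have [_ ge mx] := stopP F; rewrite pF in ge mx.
rewrite lt_neqAle ge// andbT; apply/eqP => e; apply: nF; apply: S_inj.
by apply/seteqP; split => //; exact: mx.
Qed.

End Stopping.

(** * Rounding and lacunary sums *)

Section Rounding.
Variable R : realType.
Implicit Types a b s : R.

(** Largest power of [e] not exceeding [a], with [0] sent to [0].  With rounded
    averages, strict growth along a chain is growth by a factor [e]. *)
Definition rounding (a : R) : R :=
  if a == 0 then 0 else expR (Num.floor (ln a))%:~R.

Lemma rounding_ge0 a : 0 <= rounding a.
Proof. by rewrite /rounding; case: eqP => // _; exact: expR_ge0. Qed.

Lemma rounding_le a : 0 <= a -> rounding a <= a.
Proof.
rewrite /rounding le0r; case: eqP => [->//|_ /= a0].
by rewrite -[leRHS]lnK// ler_expR floor_le.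
Qed.

Lemma le_rounding a : 0 <= a -> a <= expR 1 * rounding a.
Proof.
rewrite /rounding le0r; case: eqP => [-> _|_ /= a0]; first by rewrite mulr0.
rewrite -expRD -[leLHS]lnK// ler_expR addrC ltW//.
by rewrite -[1]/(1%:~R) -intrD floorD1_gt.
Qed.

Lemma rounding_lt a b : rounding a < rounding b ->
  expR 1 * rounding a <= rounding b.
Proof.
rewrite /rounding; case: eqP => a0; case: eqP => b0.
- by rewrite ltxx.
- by rewrite mulr0 => _; exact: expR_ge0.
- by rewrite ltNge expR_ge0.
- rewrite ltr_expR ltr_int -expRD ler_expR addrC -[1]/(1%:~R) -intrD ler_int.
  by rewrite lezD1.
Qed.

Definition geom_const (s : R) : R := (1 - (expR 1)^-1 `^ s)^-1.

Lemma geom_base s : 0 < s -> 0 <= (expR 1 : R)^-1 `^ s < 1.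
Proof.
move=> s0; rewrite powR_ge0 /=.
have {2}<- : 1 `^ s = 1 :> R by rewrite powR1.
by rewrite gt0_ltr_powR ?nnegrE ?invr_ge0 ?expR_ge0// invf_lt1 ?expR_gt0// expR_gt1.
Qed.

Lemma geom_const_gt0 s : 0 < s -> 0 < geom_const s.
Proof. by move=> /geom_base/andP[_ h]; rewrite invr_gt0 subr_gt0. Qed.

(** Distinct rounded values differ by a factor [e] at least, so the sum is
    dominated by a geometric series whose first term is its largest term. *)
Lemma sum_lacunary_le (X : finType) (C : {set X}) (A : X -> R) (s M : R) :
  0 < s -> 0 <= M -> {in C &, injective (rounding \o A)} ->
  (forall F, F \in C -> rounding (A F) <= M) ->
  \sum_(F in C) rounding (A F) `^ s <= geom_const s * M `^ s.
Proof.
move=> s0; have [n] := ubnP #|C|; elim: n C M => // n IH C M /ltnSE Cn M0 inj CM.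
have K0 := ltW (geom_const_gt0 s0).
have [->|[F0 F0C]] := set_0Vmem C.
  by rewrite big_set0 mulr_ge0// powR_ge0.
case: (@Order.TotalTheory.arg_maxP _ _ _ F0 (mem C) (rounding \o A) F0C) => F FC' Fmax.
have FC : F \in C by [].
(* The largest rounded value is split off; the others are at most [1 / e] times it. *)
rewrite (big_setD1 F)//=.
have e0 : 0 < expR 1 :> R by exact: expR_gt0.
have vF0 := rounding_ge0 (A F).
have ih : \sum_(i in (C :\ F)%SET) rounding (A i) `^ s <=
    geom_const s * (rounding (A F) / expR 1) `^ s.
  apply: IH.
  - by apply: leq_trans Cn; rewrite [ltnRHS](cardsD1 F) FC.
  - by rewrite divr_ge0// ltW.
  - by move=> G G'; rewrite !inE => /andP[_ ?] /andP[_ ?]; exact: inj.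
  - move=> G; rewrite !inE => /andP[nGF GC]; rewrite ler_pdivlMr// mulrC.
    apply: rounding_lt; rewrite lt_neqAle [_ <= _]Fmax// andbT.
    by apply: contra nGF => /eqP/inj->.
have /andP[r0 r1] := geom_base s0.
have -> : geom_const s * M `^ s =
    M `^ s + geom_const s * (M / expR 1) `^ s.
  rewrite powRM ?invr_ge0 ?(ltW e0)// /geom_const; field.
  by rewrite subr_eq0 gt_eqF.
have ps a b : 0 <= a -> a <= b -> a `^ s <= b `^ s.
  move=> a0 ab; have b0 := le_trans a0 ab.
  by rewrite ge0_ler_powR ?nnegrE// ltW.
apply: lerD; first exact/ps/CM.
apply: le_trans ih _; apply: ler_wpM2l => //; apply: ps.
  by rewrite divr_ge0// ltW.
by rewrite ler_pM2r ?invr_gt0//; exact: CM.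
Qed.

End Rounding.
Arguments rounding {R}.

(** * Integrals of nonnegative real functions *)

Lemma young_le (R : realType) (s s' a b : R) : 1 < s -> 1 < s' ->
  s^-1 + s'^-1 = 1 -> 0 <= a -> 0 <= b -> a * b <= a `^ s + b `^ s'.
Proof.
move=> s1 s1' ss' a0 b0; have s0 := lt_trans ltr01 s1.
have s0' := lt_trans ltr01 s1'.
apply: le_trans (conjugate_powR a0 b0 s0 s0' ss') _.
by apply: lerD; rewrite ler_piMr ?powR_ge0// invf_le1// ltW.
Qed.

Lemma conjugate_expE (R : realType) (s s' : R) : 1 < s -> s^-1 + s'^-1 = 1 ->
  (s - 1) * s' = s.
Proof.
move=> s1 ss'; have s0 := lt_trans ltr01 s1.
have -> : s' = s / (s - 1).
  have : s'^-1 = (s - 1) / s by rewrite mulrBl divff ?gt_eqF// mul1r -ss'; ring.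
  by move/(congr1 GRing.inv); rewrite invrK invf_div.
by field; rewrite gt_eqF// subr_gt0.
Qed.

Lemma ler_powR_base (R : realType) (s a b : R) : 0 <= s -> 0 <= a -> a <= b ->
  a `^ s <= b `^ s.
Proof.
move=> s0 a0 ab; have b0 := le_trans a0 ab.
by rewrite ge0_ler_powR ?nnegrE.
Qed.

Section RealIntegral.
Variables (d : measure_display) (T : measurableType d) (R : realType).
Variable mu : {measure set T -> \bar R}.
Implicit Types (f g h : T -> R).

Lemma ge0_le_int f g : measurable_fun setT f -> measurable_fun setT g ->
  (forall t, 0 <= f t <= g t) ->
  (\int[mu]_t (f t)%:E <= \int[mu]_t (g t)%:E)%E.
Proof.
move=> mf mg fg; apply: ge0_le_integral => //.
- by move=> t _; rewrite lee_fin; have /andP[] := fg t.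
- exact/measurable_EFinP.
- exact/measurable_EFinP.
- by move=> t _; rewrite lee_fin; have /andP[] := fg t.
Qed.

Lemma ge0_intD f g : measurable_fun setT f -> measurable_fun setT g ->
  (forall t, 0 <= f t) -> (forall t, 0 <= g t) ->
  (\int[mu]_t (f t + g t)%:E = \int[mu]_t (f t)%:E + \int[mu]_t (g t)%:E)%E.
Proof.
move=> mf mg f0 g0; under eq_integral do rewrite EFinD.
by rewrite ge0_integralD//; [move=> t _; rewrite lee_fin|exact/measurable_EFinP|
  move=> t _; rewrite lee_fin|exact/measurable_EFinP].
Qed.

Lemma ge0_intZ (c : R) f : measurable_fun setT f -> 0 <= c ->
  (forall t, 0 <= f t) ->
  (\int[mu]_t (c * f t)%:E = c%:E * \int[mu]_t (f t)%:E)%E.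
Proof.
move=> mf c0 f0; under eq_integral do rewrite EFinM.
by rewrite ge0_integralZl_EFin//; [move=> t _; rewrite lee_fin|
  exact/measurable_EFinP].
Qed.

Lemma int_ge0 f : (forall t, 0 <= f t) -> (0 <= \int[mu]_t (f t)%:E)%E.
Proof. by move=> f0; apply: integral_ge0 => t _; rewrite lee_fin. Qed.

Lemma ge0_int_sum (K : finType) (P : pred K) (f : K -> T -> R) :
  (forall k, measurable_fun setT (f k)) -> (forall k t, 0 <= f k t) ->
  (\int[mu]_t (\sum_(k | P k) f k t)%:E =
   \sum_(k | P k) \int[mu]_t (f k t)%:E)%E.
Proof.
move=> mf f0; under eq_integral do rewrite -sumEFin -big_filter.
rewrite ge0_integral_sum//; first by rewrite big_filter.
- by move=> k; exact/measurable_EFinP.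
- by move=> k t _; rewrite lee_fin.
Qed.

Lemma measurable_sum_cond (K : finType) (P : pred K) (f : K -> T -> R) :
  (forall k, measurable_fun setT (f k)) ->
  measurable_fun setT (fun t => \sum_(k | P k) f k t).
Proof.
move=> mf; under eq_fun do rewrite -big_filter; exact: measurable_sum.
Qed.

Lemma measurable_indicZ (c : R) (E : set T) : measurable E ->
  measurable_fun setT (fun t => c * \1_E t).
Proof. by move=> mE; apply: measurable_funM => //; exact: measurable_indic. Qed.

Lemma measurable_pow f (s : R) : measurable_fun setT f ->
  measurable_fun setT (fun t => f t `^ s).
Proof. by move=> mf; exact: (measurableT_comp (measurable_powR s)). Qed.

Lemma indic01 (E : set T) t : 0 <= (\1_E t : R) <= 1.
Proof. by rewrite indicE; case: (_ \in _); rewrite ?lexx ?ler01. Qed.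

Lemma indicZ_ge0 (c : R) (E : set T) t : 0 <= c -> 0 <= c * \1_E t.
Proof. by move=> c0; rewrite mulr_ge0//; have /andP[] := indic01 E t. Qed.

Lemma indic1 (E : set T) t : E t -> \1_E t = 1 :> R.
Proof. by move=> Et; rewrite indicE mem_set. Qed.

Lemma indic0 (E : set T) t : ~ E t -> \1_E t = 0 :> R.
Proof. by move=> Et; rewrite indicE memNset. Qed.

Lemma int_indicZ (c : R) (E : set T) : measurable E -> 0 <= c ->
  (\int[mu]_t (c * \1_E t)%:E = c%:E * mu E)%E.
Proof.
by move=> mE c0; rewrite ge0_intZ// integral_indic// setIT.
Qed.

Lemma int_sum_indic (K : finType) (P : pred K) (c : K -> R) (E : K -> set T) :
  (forall k, measurable (E k)) -> (forall k, mu (E k) < +oo)%E ->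
  (forall k, 0 <= c k) ->
  (\int[mu]_t (\sum_(k | P k) c k * \1_(E k) t)%:E =
   (\sum_(k | P k) c k * fine (mu (E k)))%:E)%E.
Proof.
move=> mE fE c0; rewrite ge0_int_sum.
- rewrite -sumEFin; apply: eq_bigr => k _; rewrite int_indicZ//.
  by rewrite EFinM fineK// ge0_fin_numE.
- by move=> k; exact: measurable_indicZ.
- by move=> k t; exact: indicZ_ge0.
Qed.

End RealIntegral.

(** * Maximal functions of finite families *)

Section MaxFunction.
Variables (d : measure_display) (T : measurableType d) (R : realType).
Variables (X : finType) (S : X -> set T) (A : X -> R).
Hypothesis A0 : forall x, 0 <= A x.
Implicit Type P : pred X.

Definition maxfun P (t : T) : R :=
  \big[Num.max/0]_(x | P x) (A x * \1_(S x) t).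

Lemma maxfun_ge0 P t : 0 <= maxfun P t.
Proof. exact: bigmax_ge_id. Qed.

Lemma le_maxfun P x t : P x -> S x t -> A x <= maxfun P t.
Proof.
move=> Px xt; rewrite -[leLHS]mulr1 -(@indic1 _ T R _ _ xt).
exact: (le_bigmax_cond _ (fun x => A x * \1_(S x) t)).
Qed.

Lemma maxfun_le P t M : 0 <= M -> (forall x, P x -> S x t -> A x <= M) ->
  maxfun P t <= M.
Proof.
move=> M0 AM; apply: bigmax_le => // x Px.
have [xt|xt] := pselect (S x t); first by rewrite indic1// mulr1 AM.
by rewrite indic0// mulr0.
Qed.

(** A power of a maximum is one of the powers, hence at most their sum.  This
    replaces the maximal inequality in sums over disjoint groups of stopping
    intervals. *)
Lemma maxfun_powR_le P (s : R) t : 0 < s ->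
  maxfun P t `^ s <= \sum_(x | P x) A x `^ s * \1_(S x) t.
Proof.
move=> s0; have sum0 : 0 <= \sum_(x | P x) A x `^ s * \1_(S x) t.
  by apply: sumr_ge0 => x _; rewrite indicZ_ge0// powR_ge0.
apply: (@le_trans _ _ (((\sum_(x | P x) A x `^ s * \1_(S x) t) `^ s^-1) `^ s)).
  apply: ler_powR_base; [exact: ltW|exact: maxfun_ge0|].
  apply: maxfun_le => [|x Px xt]; first exact: powR_ge0.
  rewrite -[leLHS]powRr1// -(divff (lt0r_neq0 s0)) powRrM.
  apply: ler_powR_base; [by rewrite invr_ge0 ltW|exact: powR_ge0|].
  rewrite (bigD1 x)//= indic1// mulr1 lerDl; apply: sumr_ge0 => y _.
  by rewrite indicZ_ge0// powR_ge0.
by rewrite -powRrM mulVf ?gt_eqF// powRr1.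
Qed.

Lemma measurable_maxfun P : (forall x, measurable (S x)) ->
  measurable_fun setT (maxfun P).
Proof.
move=> mS; rewrite /maxfun; elim: (index_enum X) => [|x l IH].
  by under eq_fun do rewrite big_nil; exact: measurable_cst.
under eq_fun do rewrite big_cons; case: (P x) => //.
by apply: measurable_maxr => //; exact: measurable_indicZ.
Qed.

End MaxFunction.

(** * Carleson embedding and Doob's inequality *)

Section Carleson.
Variables (d : measure_display) (T : measurableType d) (R : realType).
Variables (X : finType) (S : X -> set T).
Hypothesis S_inj : injective S.
Hypothesis S_lam : forall x y t, S x t -> S y t ->
  S x `<=` S y \/ S y `<=` S x.
Variables (A : X -> R) (stop : X -> X).
Hypothesis A0 : forall x, 0 <= A x.
Hypothesis stopP : stopping_map S (rounding \o A) stop.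

Definition stopped : pred X := [pred x | stop x == x].

Lemma stopped_stop x : stopped (stop x).
Proof. by rewrite /stopped /= (stop_idem S_inj stopP). Qed.

Lemma le_stop x : A x <= expR 1 * A (stop x).
Proof.
apply: le_trans (le_rounding (A0 x)) _; rewrite ler_pM2l ?expR_gt0//.
exact: le_trans (stop_ge stopP x) (rounding_le _).
Qed.

(** The stopping intervals that contain [t] form a chain along which the rounded
    averages are pairwise distinct, so their powers sum like a geometric
    series. *)
Lemma sum_stopped_le (s : R) t : 0 < s ->
  \sum_(x | stopped x) A x `^ s * \1_(S x) t <=
  expR 1 `^ s * geom_const s * maxfun S A stopped t `^ s.
Proof.
move=> s0; pose C := [set x | stopped x & `[< S x t >]]%SET.
have -> : \sum_(x | stopped x) A x `^ s * \1_(S x) t =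
    \sum_(x in C) A x `^ s.
  rewrite (bigID (fun x => `[< S x t >])) /= [X in _ + X]big1 ?addr0.
    apply: eq_big => [x|x /andP[_ /asboolP xt]]; first by rewrite !inE.
    by rewrite indic1// mulr1.
  by move=> x /andP[_ /asboolP xt]; rewrite indic0// mulr0.
apply: (@le_trans _ _ (\sum_(x in C) expR 1 `^ s * rounding (A x) `^ s)).
  apply: ler_sum => x _; rewrite -powRM ?expR_ge0 ?rounding_ge0//.
  by apply: ler_powR_base; [exact: ltW|exact: A0|exact: le_rounding].
rewrite -mulr_sumr -mulrA ler_wpM2l ?powR_ge0//.
apply: sum_lacunary_le => //; first exact: maxfun_ge0.
  move=> x y; rewrite !inE => /andP[/eqP px /asboolP xt] /andP[/eqP py /asboolP yt] e.
  apply/eqP; apply: contraT => /eqP nxy.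
  have [xy|yx] := S_lam xt yt.
    by have := stop_strict S_inj stopP px xy nxy; rewrite e ltxx.
  by have := stop_strict S_inj stopP py yx (nesym nxy); rewrite e ltxx.
move=> x; rewrite inE => /andP[sx /asboolP xt].
apply: le_trans (rounding_le (A0 x)) _; exact: le_maxfun.
Qed.

Variable mu : {measure set T -> \bar R}.
Hypothesis mS : forall x, measurable (S x).
Hypothesis fS : forall x, (mu (S x) < +oo)%E.

(** The left-hand side of the Carleson embedding. *)
Definition energy (r : R) := \sum_(x | stopped x) A x `^ r * fine (mu (S x)).

Lemma int_maxfun_le r (P : pred X) : 0 < r ->
  (\int[mu]_t (maxfun S A P t `^ r)%:E <=
   (\sum_(x | P x) A x `^ r * fine (mu (S x)))%:E)%E.
Proof.
move=> r0; rewrite -int_sum_indic => [||//|x]; last exact: powR_ge0.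
  apply: ge0_le_int => [||t].
  - exact/measurable_pow/measurable_maxfun.
  - by apply: measurable_sum_cond => x; exact: measurable_indicZ.
  - by rewrite powR_ge0 maxfun_powR_le.
by [].
Qed.

(** The average over [x] is at most [e] times the average over the stopping
    interval of [x], so the maximum may be restricted to stopping intervals. *)
Lemma int_maxfunT_le_energy r : 0 < r ->
  (\int[mu]_t (maxfun S A predT t `^ r)%:E <= (expR 1 `^ r * energy r)%:E)%E.
Proof.
move=> r0.
apply: (@le_trans _ _ (\int[mu]_t (expR 1 `^ r * maxfun S A stopped t `^ r)%:E)%E).
  apply: ge0_le_int => [||t].
  - exact/measurable_pow/measurable_maxfun.
  - by apply: measurable_funM => //; exact/measurable_pow/measurable_maxfun.
  - rewrite powR_ge0 /= -powRM ?expR_ge0 ?maxfun_ge0//.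
    apply: ler_powR_base; [exact: ltW|exact: maxfun_ge0|].
    apply: maxfun_le; first by rewrite mulr_ge0 ?expR_ge0 ?maxfun_ge0.
    move=> x _ xt; apply: le_trans (le_stop x) _.
    rewrite ler_pM2l ?expR_gt0//; apply: le_maxfun; first exact: stopped_stop.
    exact: (stop_sub stopP).
rewrite ge0_intZ ?powR_ge0//.
- by rewrite EFinM lee_wpmul2l ?lee_fin ?powR_ge0// int_maxfun_le.
- exact/measurable_pow/measurable_maxfun.
- by move=> t; exact: powR_ge0.
Qed.

Variable h : T -> R.
Hypothesis mh : measurable_fun setT h.
Hypothesis h0 : forall t, 0 <= h t.
Hypothesis hA : forall x,
  ((A x)%:E * mu (S x) = \int[mu]_t (h t * \1_(S x) t)%:E)%E.

Definition carleson_const (r : R) : R :=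
  2 * (2 * (expR 1 `^ (r - 1) * geom_const (r - 1))) `^ r.

Lemma carleson_const_gt0 r : 1 < r -> 0 < carleson_const r.
Proof.
move=> r1; rewrite mulr_gt0// powR_gt0// mulr_gt0// mulr_gt0 ?powR_gt0 ?expR_gt0//.
by rewrite geom_const_gt0 ?subr_gt0.
Qed.

(** As [A x * mu (S x)] is the integral of [h] over [S x], the energy is the
    integral of [h] against a sum of [r-1]-st powers over stopping intervals,
    which is dominated by the [r-1]-st power of the maximal function.  Young's
    inequality leaves a multiple of the integral of [h ^ r] and half of the
    integral of the [r]-th power of the maximal function; the latter is at most
    half of the energy, which is finite. *)
Lemma carleson_embedding r r' : 1 < r -> 1 < r' -> r^-1 + r'^-1 = 1 ->
  ((energy r)%:E <= (carleson_const r)%:E * \int[mu]_t (h t `^ r)%:E)%E.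
Proof.
move=> r1 r1' rr'; have r0 := lt_trans ltr01 r1; have r0' := lt_trans ltr01 r1'.
have s0 : 0 < r - 1 by rewrite subr_gt0.
set c := expR 1 `^ (r - 1) * geom_const (r - 1).
have c0 : 0 < c by rewrite mulr_gt0 ?powR_gt0 ?expR_gt0// geom_const_gt0.
have c20 : 0 <= 2 * c by rewrite mulr_ge0// ltW.
set m := maxfun S A stopped.
have mm : measurable_fun setT m by exact: measurable_maxfun.
have mhr : measurable_fun setT (fun t => h t `^ r) by exact: measurable_pow.
have mmr : measurable_fun setT (fun t => m t `^ r) by exact: measurable_pow.
have key : ((energy r)%:E <=
    ((2 * c) `^ r)%:E * \int[mu]_t (h t `^ r)%:E + (2^-1 * energy r)%:E)%E.
  have -> : ((energy r)%:E = \int[mu]_t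
      (\sum_(x | stopped x) A x `^ (r - 1) * (h t * \1_(S x) t))%:E)%E.
    rewrite ge0_int_sum.
    - rewrite -sumEFin; apply: eq_bigr => x _.
      rewrite ge0_intZ ?powR_ge0//.
      + rewrite -hA -[X in (_ * (_ * X))%E]fineK ?ge0_fin_numE//.
        rewrite -!EFinM mulrA; congr (_ * _)%:E.
        rewrite -{3}[A x]powRr1// -powRD ?subrK//.
        by rewrite gt_eqF.
      + by apply: measurable_funM => //; exact: measurable_indic.
      + by move=> t; exact: indicZ_ge0.
    - move=> x; apply: measurable_funM => //.
      by apply: measurable_funM => //; exact: measurable_indic.
    - by move=> x t; rewrite mulr_ge0 ?powR_ge0// indicZ_ge0.
  apply: (@le_trans _ _ (\int[mu]_t ((2 * c) `^ r * h t `^ r + 2^-1 * m t `^ r)%:E)%E).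
    apply: ge0_le_int => [||t].
    - apply: measurable_sum_cond => x; apply: measurable_funM => //.
      by apply: measurable_funM => //; exact: measurable_indic.
    - by apply: measurable_funD; apply: measurable_funM.
    apply/andP; split.
      by apply: sumr_ge0 => x _; rewrite mulr_ge0 ?powR_ge0// indicZ_ge0.
    under eq_bigr do rewrite mulrCA; rewrite -mulr_sumr.
    apply: (@le_trans _ _ (h t * (c * m t `^ (r - 1)))).
      by apply: ler_wpM2l => //; exact: sum_stopped_le.
    have -> : h t * (c * m t `^ (r - 1)) =
        (2 * c * h t) * (2^-1 * m t `^ (r - 1)) by field.
    apply: le_trans (young_le r1 r1' rr' _ _) _.
    - by rewrite mulr_ge0// mulr_ge0// ltW.
    - by rewrite mulr_ge0 ?powR_ge0.
    apply: lerD; first by rewrite [X in X <= _]powRM.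
    rewrite powRM ?powR_ge0// -powRrM.
    rewrite (conjugate_expE r1 rr').
    rewrite ler_wpM2r ?powR_ge0// -[leRHS]powRr1//.
    by apply: ger_powR; [apply/andP; split; lra|exact: ltW].
  rewrite ge0_intD; [|exact: measurable_funM|exact: measurable_funM
    |by move=> t; rewrite mulr_ge0 ?powR_ge0|by move=> t; rewrite mulr_ge0 ?powR_ge0].
  rewrite !ge0_intZ ?powR_ge0// => [|t|t]; try exact: powR_ge0.
  rewrite EFinM leeD2l// lee_wpmul2l ?lee_fin//.
  exact: int_maxfun_le.
have I0 : (0 <= \int[mu]_t (h t `^ r)%:E)%E by apply: int_ge0 => t; exact: powR_ge0.
move: key I0; rewrite /carleson_const -/c.
have P0 : 0 < (2 * c) `^ r by rewrite powR_gt0// mulr_gt0.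
case: (\int[mu]_t (h t `^ r)%:E)%E => [u||//].
- rewrite -!EFinM -EFinD !lee_fin => key u0; lra.
- by move=> _ _; rewrite gt0_muley ?leey// lte_fin mulr_gt0.
Qed.

Definition doob_const (r : R) : R := expR 1 `^ r * carleson_const r.

Lemma doob_const_gt0 r : 1 < r -> 0 < doob_const r.
Proof.
move=> r1; have := carleson_const_gt0 r1; rewrite /doob_const.
by move: (carleson_const r) => C C0; rewrite mulr_gt0 ?powR_gt0 ?expR_gt0.
Qed.

(** The maximal function is controlled by the energy, and the energy by
    [h]. *)
Lemma doob_maximal_inequality r r' : 1 < r -> 1 < r' -> r^-1 + r'^-1 = 1 ->
  (\int[mu]_t (maxfun S A predT t `^ r)%:E <=
   (doob_const r)%:E * \int[mu]_t (h t `^ r)%:E)%E.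
Proof.
move=> r1 r1' rr'; have r0 := lt_trans ltr01 r1.
apply: le_trans (int_maxfunT_le_energy r0) _.
have := carleson_embedding r1 r1' rr'; rewrite /doob_const.
move: (carleson_const r) => C eA; rewrite !EFinM -muleA.
by apply: lee_wpmul2l => //; rewrite lee_fin powR_ge0.
Qed.

End Carleson.

(** * The bilinear estimate *)

(** The relation is single-valued from [Y] to [X], so no term is counted
    twice. *)
Lemma sum_functional_relation_le (R : realType) (X Y : finType) (Q : X -> Y -> bool)
    (PX : pred X) (PY : pred Y) (f : Y -> R) :
  (forall y, 0 <= f y) -> (forall x y, Q x y -> PY y) ->
  (forall x x' y, Q x y -> Q x' y -> x = x') ->
  \sum_(x | PX x) \sum_(y | Q x y) f y <= \sum_(y | PY y) f y.
Proof.
move=> f0 QP Qf; rewrite (exchange_big_dep PY)/=; last by move=> x y _ /QP.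
apply: ler_sum => y _.
have [/existsP[x /andP[Px Qx]]|/existsPn nex] := boolP [exists x, PX x && Q x y].
  rewrite (big_pred1 x) // => x' /=; apply/idP/eqP => [/andP[_ Qx']|->]; first exact: Qf Qx.
  by rewrite Px.
by rewrite big_pred0 // => x; exact/negbTE/nex.
Qed.

Section HalfForm.
Variables (d : measure_display) (T : measurableType d) (R : realType).
Variable om : {measure set T -> \bar R}.
Variables (X K : finType) (S : X -> set T).
Hypothesis mS : forall x, measurable (S x).
Hypothesis fS : forall x, (om (S x) < +oo)%E.
Variables (P : pred K) (U V : K -> X) (c : K -> R) (E : K -> set T).
Variables (QU QV : pred X) (al be tau : X -> R) (s s' : R).
Hypothesis s1 : 1 < s.
Hypothesis s1' : 1 < s'.
Hypothesis ss' : s^-1 + s'^-1 = 1.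
Hypothesis al0 : forall x, 0 <= al x.
Hypothesis be0 : forall x, 0 <= be x.
Hypothesis c0 : forall k, 0 <= c k.
Hypothesis mE : forall k, measurable (E k).
Hypothesis fE : forall k, (om (E k) < +oo)%E.
Hypothesis EV : forall k, P k -> E k `<=` S (V k).
Hypothesis PQU : forall k, P k -> QU (U k).
Hypothesis PQV : forall k, P k -> QV (V k).
Hypothesis VU : forall k l, P k -> P l -> V k = V l -> U k = U l.
Hypothesis test : forall x,
  (\int[om]_t ((\sum_(k | P k && (U k == x)) c k * \1_(E k) t) `^ s)%:E
    <= (tau x)%:E)%E.

(** The terms are grouped by the interval [U k] on which the testing hypothesis
    is applied.  Within a group [al (U k)] is a constant and [be (V k)] is
    bounded on [E k] by a maximal function of the group, so Young's inequality
    separates the tested sum from this maximal function.  The maximal functions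
    of all groups together cost a single sum over the intervals [V k], since
    each of these belongs to one group only. *)
Lemma one_sided_testing_bound :
  \sum_(k | P k) al (U k) * c k * be (V k) * fine (om (E k)) <=
  \sum_(x | QU x) al x `^ s * tau x +
  \sum_(y | QV y) be y `^ s' * fine (om (S y)).
Proof.
have s0 := lt_trans ltr01 s1; have s0' := lt_trans ltr01 s1'.
pose Q x y := [exists k, [&& P k, U k == x & V k == y]].
rewrite (partition_big U QU)//=.
pose Phi x t := \sum_(k | P k && (U k == x)) c k * \1_(E k) t.
have Phi0 x t : 0 <= Phi x t by apply: sumr_ge0 => k _; exact: indicZ_ge0.
have mPhi x : measurable_fun setT (Phi x).
  by apply: measurable_sum_cond => k; exact: measurable_indicZ.
have one x : \sum_(k | P k && (U k == x)) al (U k) * c k * be (V k) * fine (om (E k))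
    <= al x `^ s * tau x + \sum_(y | Q x y) be y `^ s' * fine (om (S y)).
  rewrite -lee_fin -int_sum_indic//; last by move=> k; rewrite !mulr_ge0.
  have mm : measurable_fun setT (maxfun S be (Q x)) by exact: measurable_maxfun.
  apply: (@le_trans _ _ (\int[om]_t (al x `^ s * Phi x t `^ s +
      maxfun S be (Q x) t `^ s')%:E)%E).
    apply: ge0_le_int => [||t].
    - by apply: measurable_sum_cond => k; exact: measurable_indicZ.
    - apply: measurable_funD; last exact: measurable_pow.
      by apply: measurable_funM => //; exact: measurable_pow.
    apply/andP; split.
      by apply: sumr_ge0 => k _; rewrite indicZ_ge0// !mulr_ge0.
    apply: (@le_trans _ _ ((al x * Phi x t) * maxfun S be (Q x) t)).
      rewrite /Phi mulr_sumr mulr_suml; apply: ler_sum => k /andP[Pk /eqP Uk].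
      have [Et|Et] := pselect (E k t); last by rewrite indic0// !(mulr0, mul0r).
      rewrite indic1// !mulr1 Uk ler_wpM2l ?mulr_ge0//.
      apply: le_maxfun; last exact: EV Et.
      by apply/existsP; exists k; rewrite Pk Uk !eqxx.
    rewrite -powRM//; apply: young_le => //; first exact: mulr_ge0.
    exact: maxfun_ge0.
  rewrite ge0_intD; last 4 first.
  - by apply: measurable_funM => //; exact: measurable_pow.
  - exact: measurable_pow.
  - by move=> t; rewrite mulr_ge0 ?powR_ge0.
  - by move=> t; exact: powR_ge0.
  rewrite ge0_intZ ?powR_ge0//; last 2 first.
  - exact: measurable_pow.
  - by move=> t; exact: powR_ge0.
  rewrite EFinD leeD//; last exact: int_maxfun_le.
  by rewrite EFinM lee_wpmul2l ?lee_fin ?powR_ge0//; exact: test.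
apply: le_trans (ler_sum _ (fun x _ => one x)) _.
rewrite big_split /= lerD2l; apply: sum_functional_relation_le.
- by move=> y; rewrite mulr_ge0 ?powR_ge0 ?fine_ge0.
- by move=> x y /existsP[k /and3P[Pk _ /eqP <-]]; exact: PQV.
- move=> x x' y /existsP[k /and3P[Pk /eqP <- /eqP <-]].
  by move=> /existsP[l /and3P[Pl /eqP <- /eqP Vlk]]; exact: VU.
Qed.

End HalfForm.

Lemma add_scaled_bounds (R : realType) (e C C' x y : R) (u w : \bar R) :
  0 < e -> 0 < C -> 0 < C' -> (0 <= u)%E -> (0 <= w)%E ->
  (x%:E <= C%:E * u)%E -> (y%:E <= C'%:E * w)%E ->
  ((e * (2 * (x + y)))%:E <= (2 * e * (C + C'))%:E * (u + w))%E.
Proof.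
move=> e0 C0 C0'; have K0 : 0 < 2 * e * (C + C').
  by rewrite mulr_gt0 ?addr_gt0// mulr_gt0.
case: u => [u||//]; last first.
  by move=> _ w0 _ _; rewrite addye ?gt0_muley ?leey ?lte_fin// -ltNye (lt_le_trans _ w0)// ltNy0.
case: w => [w||//]; last first.
  by move=> _ _ _ _; rewrite addey// gt0_muley ?leey ?lte_fin.
rewrite -EFinD -!EFinM !lee_fin => u0 w0 xu yw.
rewrite mulrA [2 * _]mulrC -[leRHS]mulrA ler_wpM2l ?mulr_ge0 ?(ltW e0)//.
have h1 : 0 <= C * w by rewrite mulr_ge0// ltW.
have h2 : 0 <= C' * u by rewrite mulr_ge0// ltW.
nra.
Qed.

Section Bilinear.
Variables (d : measure_display) (T : measurableType d) (R : realType).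
Variables mu nu : {measure set T -> \bar R}.
Variables (X K : finType) (S : X -> set T) (top bot : K -> X) (a : K -> R).
Hypothesis S_inj : injective S.
Hypothesis S_ne : forall x, S x !=set0.
Hypothesis S_lam : forall x y t, S x t -> S y t ->
  S x `<=` S y \/ S y `<=` S x.
Hypothesis mS : forall x, measurable (S x).
Hypothesis fmu : forall x, (mu (S x) < +oo)%E.
Hypothesis fnu : forall x, (nu (S x) < +oo)%E.
Hypothesis a0 : forall k, 0 <= a k.
Hypothesis bot_top : forall k, S (bot k) `<=` S (top k).
Hypothesis cover : forall k z, S (bot k) `<=` S z -> z <> bot k ->
  S (top k) `<=` S z.
Variables (s s' : R).
Hypothesis s1 : 1 < s.
Hypothesis s1' : 1 < s'.
Hypothesis ss' : s^-1 + s'^-1 = 1.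

(** The coefficient of [1_(top k)] in the adjoint applied to the constant
    function [1]: the [nu]-integral of [a k 1_(bot k)] spread over [top k] with
    respect to [mu].  It vanishes if [top k] is [mu]-null. *)
Definition dual_coef k := a k * fine (nu (S (bot k))) / fine (mu (S (top k))).

Hypothesis test : forall z,
  (\int[nu]_t ((\sum_(k | `[< S (top k) `<=` S z >]) a k * \1_(S (bot k)) t) `^ s)%:E
    <= mu (S z))%E.
Hypothesis dual_test : forall z,
  (\int[mu]_t ((\sum_(k | `[< S (top k) `<=` S z >])
     dual_coef k * \1_(S (top k)) t) `^ s')%:E
    <= nu (S z))%E.

Variables (A B : X -> R) (f g : T -> R).
Hypothesis A0 : forall x, 0 <= A x.
Hypothesis B0 : forall x, 0 <= B x.
Hypothesis Anull : forall x, mu (S x) = 0 -> A x = 0.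
Hypothesis mf : measurable_fun setT f.
Hypothesis mg : measurable_fun setT g.
Hypothesis f0 : forall t, 0 <= f t.
Hypothesis g0 : forall t, 0 <= g t.
Hypothesis fA : forall x,
  ((A x)%:E * mu (S x) = \int[mu]_t (f t * \1_(S x) t)%:E)%E.
Hypothesis gB : forall x,
  ((B x)%:E * nu (S x) = \int[nu]_t (g t * \1_(S x) t)%:E)%E.

Lemma int_powR_sum_subset (om : {measure set T -> \bar R}) (P Q : pred K) (c : K -> R)
    (E : K -> set T) (r : R) : 0 <= r ->
  (forall k, measurable (E k)) -> (forall k, 0 <= c k) ->
  (forall k, P k -> Q k) ->
  (\int[om]_t ((\sum_(k | P k) c k * \1_(E k) t) `^ r)%:E <=
   \int[om]_t ((\sum_(k | Q k) c k * \1_(E k) t) `^ r)%:E)%E.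
Proof.
move=> r0 mE c0 PQ; apply: ge0_le_int => [||t].
- by apply: measurable_pow; apply: measurable_sum_cond => k; exact: measurable_indicZ.
- by apply: measurable_pow; apply: measurable_sum_cond => k; exact: measurable_indicZ.
rewrite powR_ge0 /=; apply: ler_powR_base => //.
  by apply: sumr_ge0 => k _; exact: indicZ_ge0.
rewrite [leRHS](bigID P) /= [X in _ <= X + _](eq_bigl P).
  by rewrite lerDl; apply: sumr_ge0 => k _; exact: indicZ_ge0.
by move=> k; apply/andP/idP => [[]//|Pk]; split => //; exact: PQ.
Qed.

Lemma dual_coef_ge0 k : 0 <= dual_coef k.
Proof. by rewrite /dual_coef !mulr_ge0 ?invr_ge0 ?fine_ge0. Qed.

Definition bilinear_const := 2 * expR 1 ^+ 2 * (carleson_const s + carleson_const s').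

(** Let [F k] be the stopping interval of the parent for the averages [A] and
    [G k] that of the child for the averages [B].  They are nested.  The pairs
    with [F k] inside [G k] are handled by the dual testing condition, with
    [F k] attached to [G k]; the others by the direct one, with [G k] attached
    to [F k]. *)
Lemma bilinear_le :
  ((\sum_k A (top k) * a k * B (bot k) * fine (nu (S (bot k))))%:E <=
   bilinear_const%:E * (\int[mu]_t (f t `^ s)%:E + \int[nu]_t (g t `^ s')%:E))%E.
Proof.
have [pf pfP] := stopping_map_exists S_ne S_lam (rounding \o A).
have [pg pgP] := stopping_map_exists S_ne S_lam (rounding \o B).
have ss'' : s'^-1 + s^-1 = 1 by rewrite addrC.
have s0 := lt_trans ltr01 s1; have s0' := lt_trans ltr01 s1'.
have eA := carleson_embedding S_inj S_lam A0 pfP mS fmu mf f0 fA s1 s1' ss'.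
have eB := carleson_embedding S_inj S_lam B0 pgP mS fnu mg g0 gB s1' s1 ss''.
pose F k := pf (top k); pose G k := pg (bot k).
pose le x y := `[< S x `<=` S y >].
have leP x y : reflect (S x `<=` S y) (le x y) by exact: asboolP.
have cases k : le (F k) (G k) \/ le (G k) (F k) /\ F k <> G k.
  have [t bt] := S_ne (bot k).
  have Ft : S (F k) t by apply: (stop_sub pfP); exact: bot_top.
  have Gt : S (G k) t by exact: (stop_sub pgP).
  have [FG|GF] := S_lam Ft Gt; first by left; exact/leP.
  have [e|ne] := pselect (F k = G k); last by right; split => //; exact/leP.
  by left; rewrite e; exact/leP.
pose P2 k := le (F k) (G k).
have dual_part : \sum_(k | P2 k) B (G k) * dual_coef k * A (F k) * fine (mu (S (top k)))
    <= energy S B pg nu s' + energy S A pf mu s.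
  apply: (@one_sided_testing_bound _ _ _ mu _ _ S mS fmu P2 G F dual_coef (fun k => S (top k))) => //.
  - exact: dual_coef_ge0.
  - by move=> k _; exact: (stop_sub pfP).
  - by move=> k _; exact: (stopped_stop S_inj pgP).
  - by move=> k _; exact: (stopped_stop S_inj pfP).
  (* [F k] lies between the child and [G k], so [G k] is also the stopping interval
     of [F k] and is determined by it. *)
  - suff H k : P2 k -> G k = pg (F k) by move=> k l Pk Pl e; rewrite !H// e.
    move=> /leP FG; symmetry; apply: (stop_between S_inj pgP) => // t bt.
    by apply: (stop_sub pfP); exact: bot_top.
  - move=> z; rewrite fineK ?ge0_fin_numE//; apply: le_trans (dual_test z).
    apply: int_powR_sum_subset => //; [exact: ltW|exact: dual_coef_ge0|].
    move=> k /andP[/leP FG /eqP <-]; apply/asboolP => t kt.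
    by apply: FG; exact: (stop_sub pfP).
have direct_part : \sum_(k | ~~ P2 k) A (F k) * a k * B (G k) * fine (nu (S (bot k)))
    <= energy S A pf mu s + energy S B pg nu s'.
  have P1 k : ~~ P2 k -> S (G k) `<=` S (F k) /\ F k <> G k.
    by have [h|[/leP ? ?] _//] := cases k; rewrite /P2 h.
  apply: (@one_sided_testing_bound _ _ _ nu _ _ S mS fnu (predC P2) F G a (fun k => S (bot k))) => //.
  - by move=> k _; exact: (stop_sub pgP).
  - by move=> k _; exact: (stopped_stop S_inj pfP).
  - by move=> k _; exact: (stopped_stop S_inj pgP).
  - move=> k l Pk Pl e.
    have [GFk nek] := P1 _ Pk; have [GFl nel] := P1 _ Pl.
    (* If two pairs share [G], the parent of each lies in the [F] of the other, since
       that [F] is strictly larger than the child.  The smaller one of the two [F]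
       then has the larger one as stopping interval, and is its own. *)
    have topF m n : S (G m) `<=` S (F m) -> F m <> G m -> G m = G n ->
        S (top n) `<=` S (F m).
      move=> GFm nem emn; apply: cover.
        by move=> t bt; apply: GFm; rewrite emn; exact: (stop_sub pgP).
      move=> Fb; apply: nem; apply: S_inj; apply/seteqP; split => //.
      by rewrite Fb emn; exact: (stop_sub pgP).
    have kl := topF _ _ GFk nek e; have lk := topF _ _ GFl nel (esym e).
    have [t bt] := S_ne (G k).
    have Flt : S (F l) t by apply: GFl; rewrite -e.
    have [FF|FF] := S_lam (GFk _ bt) Flt.
      by have := stop_between S_inj pfP kl FF; rewrite (stop_idem S_inj pfP).
    have := stop_between S_inj pfP lk FF; rewrite (stop_idem S_inj pfP) => h.
    exact: esym h.
  - move=> z; rewrite fineK ?ge0_fin_numE//; apply: le_trans (test z).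
    apply: int_powR_sum_subset => //; first exact: ltW.
    move=> k /andP[_ /eqP <-]; apply/asboolP.
    exact: (stop_sub pfP).
have e0 : 0 <= expR 1 :> R by exact: expR_ge0.
have tot : \sum_k A (top k) * a k * B (bot k) * fine (nu (S (bot k))) <=
    expR 1 ^+ 2 * (2 * (energy S A pf mu s + energy S B pg nu s')).
  rewrite (bigID P2) /=.
  apply: (@le_trans _ _ (expR 1 ^+ 2 *
     (\sum_(k | P2 k) B (G k) * dual_coef k * A (F k) * fine (mu (S (top k)))) +
     expR 1 ^+ 2 *
     \sum_(k | ~~ P2 k) A (F k) * a k * B (G k) * fine (nu (S (bot k))))); last first.
    rewrite -mulrDr ler_wpM2l ?exprn_ge0//; lra.
  have AB k : A (top k) * B (bot k) <= expR 1 ^+ 2 * (A (F k) * B (G k)).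
    have -> : expR 1 ^+ 2 * (A (F k) * B (G k)) =
      (expR 1 * A (F k)) * (expR 1 * B (G k)) by ring.
    by apply: ler_pM => //; [exact: (le_stop A0 pfP)|exact: (le_stop B0 pgP)].
  rewrite !mulr_sumr; apply: lerD; apply: ler_sum => k _; last first.
    rewrite [leLHS](_ : _ = A (top k) * B (bot k) * (a k * fine (nu (S (bot k))))); last by ring.
    rewrite [leRHS](_ : _ = expR 1 ^+ 2 * (A (F k) * B (G k)) * (a k * fine (nu (S (bot k))))); last by ring.
    by apply: ler_wpM2r; rewrite // mulr_ge0 ?fine_ge0.
  rewrite /dual_coef; have [m0|m0] := eqVneq (mu (S (top k))) 0.
    by rewrite Anull// m0 /= !(mulr0, mul0r).
  have fm0 : fine (mu (S (top k))) != 0 by rewrite fine_eq0 ?ge0_fin_numE.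
  rewrite [leLHS](_ : _ = A (top k) * B (bot k) * (a k * fine (nu (S (bot k))))); last by ring.
  rewrite [leRHS](_ : _ = expR 1 ^+ 2 * (A (F k) * B (G k)) * (a k * fine (nu (S (bot k))))); last by field.
  by apply: ler_wpM2r; rewrite // mulr_ge0 ?fine_ge0.
have e20 : 0 < expR 1 ^+ 2 :> R by rewrite exprn_gt0// expR_gt0.
apply: (@le_trans _ _
  (expR 1 ^+ 2 * (2 * (energy S A pf mu s + energy S B pg nu s')))%:E).
  by rewrite lee_fin.
apply: add_scaled_bounds eA eB => //; try exact: carleson_const_gt0.
- by apply: int_ge0 => t; exact: powR_ge0.
- by apply: int_ge0 => t; exact: powR_ge0.
Qed.

End Bilinear.

(** * Averages and the norm estimate *)

Lemma integral_indicE (d : measure_display) (T : measurableType d) (R : realType)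
    (mu : {measure set T -> \bar R}) (E : set T) (f : T -> R) :
  (\int[mu]_(t in E) (f t)%:E = \int[mu]_t (f t * \1_E t)%:E)%E.
Proof.
by rewrite integral_mkcond epatch_indic; apply: eq_integral => t _ /=.
Qed.

Lemma sum_indic_powR_le (d : measure_display) (T : measurableType d) (R : realType) (K : finType) (P : pred K)
    (c : K -> R) (E : K -> set T) (s : R) t : 0 < s -> (forall k, 0 <= c k) ->
  (\sum_(k | P k) c k * \1_(E k) t) `^ s <=
  \sum_(k | P k) (\sum_(l | P l) c l) `^ s * \1_(E k) t.
Proof.
move=> s0 c0; have cs0 : 0 <= \sum_(l | P l) c l by exact: sumr_ge0.
have i01 k := indic01 R (E k) t.
have [/existsP[k /andP[Pk /asboolP Et]]|/existsPn nE] :=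
    boolP [exists k, P k && `[< E k t >]].
  rewrite (bigD1 k) //= [leRHS](bigD1 k)//= [in leRHS]indicE mem_set// mulr1.
  apply: (@le_trans _ _ ((\sum_(l | P l) c l) `^ s)).
    rewrite -(bigD1 k (P := P) (F := fun k => c k * \1_(E k) t))//=.
    apply: ler_powR_base; first exact: ltW.
      by apply: sumr_ge0 => l _; rewrite mulr_ge0//; have /andP[] := i01 l.
    by apply: ler_sum => l _; rewrite ler_piMr//; have /andP[] := i01 l.
  rewrite lerDl; apply: sumr_ge0 => l _.
  by rewrite mulr_ge0 ?powR_ge0//; have /andP[] := i01 l.
rewrite big1; first rewrite powR0 ?gt_eqF//.
  by apply: sumr_ge0 => l _; rewrite mulr_ge0 ?powR_ge0//; have /andP[] := i01 l.
move=> k Pk; have := nE k; rewrite Pk /= => /asboolPn nk.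
by rewrite indicE memNset// mulr0.
Qed.

Section Averages.
Variables (d : measure_display) (T : measurableType d) (R : realType).
Variable mu : {measure set T -> \bar R}.

Lemma int_sum_indic_powR_lty (K : finType) (P : pred K)
    (c : K -> R) (E : K -> set T) (s : R) : 0 < s ->
  (forall k, 0 <= c k) -> (forall k, measurable (E k)) ->
  (forall k, mu (E k) < +oo)%E ->
  (\int[mu]_t ((\sum_(k | P k) c k * \1_(E k) t) `^ s)%:E < +oo)%E.
Proof.
move=> s0 c0 mE fE.
apply: (@le_lt_trans _ _ (\int[mu]_t
    (\sum_(k | P k) (\sum_(l | P l) c l) `^ s * \1_(E k) t)%:E)%E).
  apply: ge0_le_int => [||t].
  - by apply: measurable_pow; apply: measurable_sum_cond => k; exact: measurable_indicZ.
  - by apply: measurable_sum_cond => k; exact: measurable_indicZ.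
  - by rewrite powR_ge0 sum_indic_powR_le.
by rewrite int_sum_indic ?ltry// => k; exact: powR_ge0.
Qed.

(** The value is [0] if [E] is null or if the integral is infinite. *)
Definition aver (E : set T) (g : T -> R) : R := fine (avg mu E (EFin \o g)).

(** On a set of finite measure, [g] is dominated by [g ^ s + 1]. *)
Lemma int_indic_lty (E : set T) (g : T -> R) (s : R) : 1 < s ->
  measurable_fun setT g -> (forall t, 0 <= g t) ->
  (\int[mu]_t (g t `^ s)%:E < +oo)%E -> measurable E -> (mu E < +oo)%E ->
  (\int[mu]_t (g t * \1_E t)%:E < +oo)%E.
Proof.
move=> s1 mg g0 fg mE fE; have s0 := lt_trans ltr01 s1.
apply: (@le_lt_trans _ _ (\int[mu]_t (g t `^ s + \1_E t)%:E)%E).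
  apply: ge0_le_int => [||t].
  - by apply: measurable_funM => //; exact: measurable_indic.
  - by apply: measurable_funD; [exact: measurable_pow|exact: measurable_indic].
  rewrite indicZ_ge0//=.
  have [Et|Et] := pselect (E t); last by rewrite !indic0// mulr0 addr0 powR_ge0.
  rewrite indic1// mulr1; have [g1|/ltW g1] := leP (g t) 1.
    by rewrite (le_trans g1)// lerDr powR_ge0.
  by rewrite -[leLHS]powRr1// (le_trans (ler_powR g1 (ltW s1)))// lerDl.
rewrite ge0_intD.
- by rewrite integral_indic// setIT lte_add_pinfty.
- exact: measurable_pow.
- exact: measurable_indic.
- by move=> t; exact: powR_ge0.
- by move=> t; have /andP[] := indic01 R E t.
Qed.

Lemma aver_ge0 (E : set T) (g : T -> R) : (forall t, 0 <= g t) -> 0 <= aver E g.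
Proof.
move=> g0; rewrite fine_ge0// mule_ge0 ?lee_fin ?invr_ge0 ?fine_ge0//.
by apply: integral_ge0 => t _; rewrite lee_fin.
Qed.

Lemma aver_null (E : set T) (g : T -> R) : mu E = 0 -> aver E g = 0.
Proof. by move=> E0; rewrite /aver /avg E0 /= invr0 mul0e. Qed.

Lemma averE (E : set T) (g : T -> R) : measurable_fun setT g -> (forall t, 0 <= g t) ->
  measurable E -> (mu E < +oo)%E -> (\int[mu]_t (g t * \1_E t)%:E < +oo)%E ->
  ((aver E g)%:E * mu E = \int[mu]_t (g t * \1_E t)%:E)%E.
Proof.
move=> mg g0 mE fE fg.
have [E0|E0] := eqVneq (mu E) 0%E.
  rewrite E0 mule0 -integral_indicE null_set_integral//.
  exact/measurable_EFinP/measurable_funTS.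
have fin : (\int[mu]_t (g t * \1_E t)%:E)%E \is a fin_num.
  by rewrite ge0_fin_numE// int_ge0// => t; exact: indicZ_ge0.
rewrite /aver /avg integral_indicE /= -[in RHS](fineK fin) -[in LHS](fineK fin) -EFinM /=.
rewrite -[X in (_ * X)%E]fineK ?ge0_fin_numE// -EFinM; congr _%:E; field.
by rewrite fine_eq0// ge0_fin_numE.
Qed.

End Averages.

(** The positive solution [x] of [C * x ^ s = x / 2], that is, the scale at which
    half of the left-hand side can be absorbed. *)
Definition absorb_delta (R : realType) (C s : R) := (2 * C) `^ (- (s - 1)^-1).

Lemma absorb_delta_gt0 (R : realType) (C s : R) : 0 < C -> 0 < absorb_delta C s.
Proof. by move=> C0; rewrite powR_gt0// mulr_gt0. Qed.

Lemma absorb_deltaE (R : realType) (C s : R) : 0 < C -> 1 < s ->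
  C * absorb_delta C s `^ s = absorb_delta C s / 2.
Proof.
move=> C0 s1; have de0 := absorb_delta_gt0 s C0.
have -> : absorb_delta C s `^ s = absorb_delta C s * absorb_delta C s `^ (s - 1).
  move: (absorb_delta C s) de0 => x x0.
  have {1}-> : s = 1 + (s - 1) by ring.
  have h : (1 + (s - 1) == 0) ==> (x != 0) by rewrite (gt_eqF x0) implybT.
  by rewrite (powRD h) powRr1 ?(ltW x0).
have -> : absorb_delta C s `^ (s - 1) = (2 * C)^-1.
  rewrite -powRrM mulNr mulVf ?powRN ?powRr1//.
    by rewrite mulr_ge0// ltW.
  by rewrite gt_eqF// subr_gt0.
by field; rewrite gt_eqF.
Qed.

Section StrongFinite.
Variables (d : measure_display) (T : measurableType d) (R : realType).
Variables mu nu : {measure set T -> \bar R}.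
Variables (X K : finType) (S : X -> set T) (top bot : K -> X).
Hypothesis S_inj : injective S.
Hypothesis S_ne : forall x, S x !=set0.
Hypothesis S_lam : forall x y t, S x t -> S y t ->
  S x `<=` S y \/ S y `<=` S x.
Hypothesis mS : forall x, measurable (S x).
Hypothesis fmu : forall x, (mu (S x) < +oo)%E.
Hypothesis fnu : forall x, (nu (S x) < +oo)%E.
Hypothesis bot_top : forall k, S (bot k) `<=` S (top k).
Hypothesis cover : forall k z, S (bot k) `<=` S z -> z <> bot k ->
  S (top k) `<=` S z.
Variables (s s' : R).
Hypothesis s1 : 1 < s.
Hypothesis s1' : 1 < s'.
Hypothesis ss' : s^-1 + s'^-1 = 1.
Variables (A : X -> R) (f : T -> R).
Hypothesis A0 : forall x, 0 <= A x.
Hypothesis Anull : forall x, mu (S x) = 0 -> A x = 0.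
Hypothesis mf : measurable_fun setT f.
Hypothesis f0 : forall t, 0 <= f t.
Hypothesis fA : forall x,
  ((A x)%:E * mu (S x) = \int[mu]_t (f t * \1_(S x) t)%:E)%E.

Definition strong_const : R :=
  let K := bilinear_const s s' in 2 * K / absorb_delta K s'.

Lemma bilinear_const_gt0 : 0 < bilinear_const s s'.
Proof.
apply: mulr_gt0.
  by apply: mulr_gt0 => //; rewrite exprn_gt0// expR_gt0.
by apply: addr_gt0; exact: carleson_const_gt0.
Qed.

Lemma strong_const_gt0 : 0 < strong_const.
Proof.
have K0 := bilinear_const_gt0; rewrite /strong_const.
by move: (bilinear_const s s') K0 => C C0; rewrite divr_gt0 ?absorb_delta_gt0 ?mulr_gt0.
Qed.

(** The bilinear estimate is applied to [g = delta * W ^ (s - 1)], where [W] is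
    the image of [f].  Then the form is [delta] times the integral of [W ^ s],
    and the choice of [delta] allows half of it to be absorbed.  The integral is
    finite because [W] is a finite combination of indicators of sets of finite
    measure. *)
Lemma strong_estimate_normalized (a : K -> R) : (forall k, 0 <= a k) ->
  (forall z, (\int[nu]_t ((\sum_(k | `[< S (top k) `<=` S z >])
      a k * \1_(S (bot k)) t) `^ s)%:E <= mu (S z))%E) ->
  (forall z, (\int[mu]_t ((\sum_(k | `[< S (top k) `<=` S z >])
      dual_coef mu nu S top bot a k * \1_(S (top k)) t) `^ s')%:E <= nu (S z))%E) ->
  (\int[nu]_t ((\sum_k A (top k) * a k * \1_(S (bot k)) t) `^ s)%:E <=
   strong_const%:E * \int[mu]_t (f t `^ s)%:E)%E.
Proof.
move=> a0 test dual_test.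
have s0 := lt_trans ltr01 s1; have s0' := lt_trans ltr01 s1'.
set W := fun t => \sum_k A (top k) * a k * \1_(S (bot k)) t.
have c0 k : 0 <= A (top k) * a k by rewrite mulr_ge0.
have W0 t : 0 <= W t by apply: sumr_ge0 => k _; exact: indicZ_ge0.
have mW : measurable_fun setT W.
  by apply: measurable_sum_cond => k; exact: measurable_indicZ.
have fW : (\int[nu]_t (W t `^ s)%:E < +oo)%E by exact: int_sum_indic_powR_lty.
have bil B g := @bilinear_le _ _ _ _ _ _ _ _ _ _ _ S_inj S_ne S_lam mS fmu
  fnu a0 bot_top cover _ _ s1 s1' ss' test dual_test A B f g A0.
have {}bil B g B0 mg g0 gB := bil B g B0 Anull mf mg f0 g0 fA gB.
have K0 := bilinear_const_gt0.
rewrite /strong_const; move: (bilinear_const s s') K0 bil => C K0 bil.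
have de0 := absorb_delta_gt0 s' K0; have deE := absorb_deltaE K0 s1'.
move: (absorb_delta C s') de0 deE => de de0 deE.
pose g t := de * W t `^ (s - 1).
have g0 t : 0 <= g t by rewrite mulr_ge0 ?powR_ge0// ltW.
have mg : measurable_fun setT g.
  by apply: measurable_funM => //; exact: measurable_pow.
have gE t : g t `^ s' = de `^ s' * W t `^ s.
  by rewrite powRM ?powR_ge0 ?(ltW de0)// -powRrM (conjugate_expE s1 ss').
have Ig : (\int[nu]_t (g t `^ s')%:E =
    (de `^ s')%:E * \int[nu]_t (W t `^ s)%:E)%E.
  under eq_integral do rewrite gE.
  by rewrite ge0_intZ ?powR_ge0//; [exact: measurable_pow|move=> t; exact: powR_ge0].
have fg : (\int[nu]_t (g t `^ s')%:E < +oo)%E.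
  by rewrite Ig lte_mul_pinfty ?lee_fin ?powR_ge0.
pose B x := aver nu (S x) g.
have gB x : ((B x)%:E * nu (S x) = \int[nu]_t (g t * \1_(S x) t)%:E)%E.
  by apply: averE => //; exact: (int_indic_lty s1').
have B0 x : 0 <= B x by exact: aver_ge0.
have := bil B g B0 mg g0 gB.
have -> : ((\sum_k A (top k) * a k * B (bot k) * fine (nu (S (bot k))))%:E =
    de%:E * \int[nu]_t (W t `^ s)%:E)%E.
  transitivity (\int[nu]_t (\sum_k A (top k) * a k * (g t * \1_(S (bot k)) t))%:E)%E.
    rewrite ge0_int_sum.
    - rewrite -sumEFin; apply: eq_bigr => k _; rewrite ge0_intZ//.
      + by rewrite -gB -[X in (_ * (_ * X))%E]fineK ?ge0_fin_numE// -!EFinM mulrA.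
      + by apply: measurable_funM => //; exact: measurable_indic.
      + by move=> t; exact: indicZ_ge0.
    - move=> k; apply: measurable_funM => //.
      by apply: measurable_funM => //; exact: measurable_indic.
    - by move=> k t; rewrite mulr_ge0// indicZ_ge0.
  rewrite -ge0_intZ ?(ltW de0)//; last 2 first.
  - exact: measurable_pow.
  - by move=> t; exact: powR_ge0.
  apply: eq_integral => t _; congr _%:E.
  under eq_bigr do rewrite mulrCA; rewrite -mulr_sumr -/(W t) /g -mulrA.
  congr (_ * _); rewrite -{2}[W t]powRr1// -powRD ?subrK//.
  by rewrite gt_eqF.
rewrite Ig.
have If0 : (0 <= \int[mu]_t (f t `^ s)%:E)%E by apply: int_ge0 => t; exact: powR_ge0.
have IW0 : (0 <= \int[nu]_t (W t `^ s)%:E)%E by apply: int_ge0 => t; exact: powR_ge0.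
have C0 := strong_const_gt0.
have W_fin : (\int[nu]_t (W t `^ s)%:E)%E \is a fin_num by rewrite ge0_fin_numE.
move: If0 IW0; rewrite -(fineK W_fin); move: (fine _) => w.
case: (\int[mu]_t (f t `^ s)%:E)%E => [u||//]; last first.
  by move=> _ _ _; rewrite gt0_muley ?leey// lte_fin divr_gt0// mulr_gt0.
move=> u0 w0; rewrite -(EFinM de) -(EFinM (de `^ s')) -(EFinD u) -!EFinM !lee_fin.
by rewrite mulrDr mulrA deE => h; rewrite mulrAC ler_pdivlMr//; lra.
Qed.

End StrongFinite.

(** * Normalization and necessity of the dual condition *)

Section ScaledStrong.
Variables (d : measure_display) (T : measurableType d) (R : realType).
Variables mu nu : {measure set T -> \bar R}.
Variables (X K : finType) (S : X -> set T) (top bot : K -> X).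
Hypothesis S_inj : injective S.
Hypothesis S_ne : forall x, S x !=set0.
Hypothesis S_lam : forall x y t, S x t -> S y t ->
  S x `<=` S y \/ S y `<=` S x.
Hypothesis mS : forall x, measurable (S x).
Hypothesis fmu : forall x, (mu (S x) < +oo)%E.
Hypothesis fnu : forall x, (nu (S x) < +oo)%E.
Hypothesis bot_top : forall k, S (bot k) `<=` S (top k).
Variables (s s' : R).
Hypothesis s1 : 1 < s.
Hypothesis s1' : 1 < s'.
Hypothesis ss' : s^-1 + s'^-1 = 1.
Variable a : K -> R.
Hypothesis a0 : forall k, 0 <= a k.

Lemma powR_sum_scale (P : pred K) (c : K -> R) (E : K -> set T) (D r : R) t :
  0 < D -> (forall k, 0 <= c k) ->
  (\sum_(k | P k) c k / D * \1_(E k) t) `^ r =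
  (D `^ r)^-1 * (\sum_(k | P k) c k * \1_(E k) t) `^ r.
Proof.
move=> D0 c0; have -> : \sum_(k | P k) c k / D * \1_(E k) t =
    D^-1 * \sum_(k | P k) c k * \1_(E k) t.
  by rewrite mulr_sumr; apply: eq_bigr => k _; rewrite mulrAC mulrC mulrA.
rewrite powRM ?invr_ge0 ?(ltW D0)//; last first.
  by apply: sumr_ge0 => k _; exact: indicZ_ge0.
by congr (_ * _); rewrite -powR_inv1 ?(ltW D0)// -powRrM mulN1r powRN.
Qed.

Lemma int_powR_sum_scale (om : {measure set T -> \bar R}) (P : pred K)
    (c : K -> R) (E : K -> set T) (D r : R) (M : \bar R) :
  0 < D -> (forall k, 0 <= c k) -> (forall k, measurable (E k)) ->
  (\int[om]_t ((\sum_(k | P k) c k * \1_(E k) t) `^ r)%:E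
     <= (D `^ r)%:E * M)%E ->
  (\int[om]_t ((\sum_(k | P k) c k / D * \1_(E k) t) `^ r)%:E <= M)%E.
Proof.
move=> D0 c0 mE; under [in X in _ -> X]eq_integral do rewrite powR_sum_scale//.
rewrite ge0_intZ.
- move=> h; have Dr0 : 0 < D `^ r by rewrite powR_gt0.
  rewrite -[leRHS]mul1e -(@mulVf _ (D `^ r)) ?gt_eqF// EFinM -muleA.
  by rewrite lee_wpmul2l// lee_fin invr_ge0 ltW.
- by apply: measurable_pow; apply: measurable_sum_cond => k; exact: measurable_indicZ.
- by rewrite invr_ge0 powR_ge0.
- by move=> t; exact: powR_ge0.
Qed.

(** Division of the coefficients by [D] reduces this to testing constants equal
    to [1]. *)
Lemma strong_estimate (A : X -> R) (f : T -> R) (D : R) :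
  (forall k z, S (bot k) `<=` S z -> z <> bot k -> S (top k) `<=` S z) ->
  (forall x, 0 <= A x) -> (forall x, mu (S x) = 0 -> A x = 0) ->
  measurable_fun setT f -> (forall t, 0 <= f t) ->
  (forall x, ((A x)%:E * mu (S x) = \int[mu]_t (f t * \1_(S x) t)%:E)%E) ->
  0 < D ->
  (forall z, (\int[nu]_t ((\sum_(k | `[< S (top k) `<=` S z >])
      a k * \1_(S (bot k)) t) `^ s)%:E <= (D `^ s)%:E * mu (S z))%E) ->
  (forall z, (\int[mu]_t ((\sum_(k | `[< S (top k) `<=` S z >])
      dual_coef mu nu S top bot a k * \1_(S (top k)) t) `^ s')%:E
      <= (D `^ s')%:E * nu (S z))%E) ->
  (\int[nu]_t ((\sum_k A (top k) * a k * \1_(S (bot k)) t) `^ s)%:E <=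
   (strong_const s s')%:E * ((D `^ s)%:E * \int[mu]_t (f t `^ s)%:E))%E.
Proof.
move=> cover A0 Anull mf f0 fA D0 test dual_test.
have mE P (c : K -> R) (E : K -> set T) : (forall k, measurable (E k)) ->
    measurable_fun setT (fun t => (\sum_(k | P k) c k * \1_(E k) t) `^ s).
  by move=> ?; apply: measurable_pow; apply: measurable_sum_cond => k; exact: measurable_indicZ.
have a'0 k : 0 <= a k / D by rewrite divr_ge0// ltW.
have test1 z : (\int[nu]_t ((\sum_(k | `[< S (top k) `<=` S z >])
    a k / D * \1_(S (bot k)) t) `^ s)%:E <= mu (S z))%E.
  exact: int_powR_sum_scale D0 a0 _ (test z).
have test2 z : (\int[mu]_t ((\sum_(k | `[< S (top k) `<=` S z >])
    dual_coef mu nu S top bot (fun k => a k / D) k * \1_(S (top k)) t) `^ s')%:E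
    <= nu (S z))%E.
  have dE k : dual_coef mu nu S top bot (fun k => a k / D) k =
      dual_coef mu nu S top bot a k / D.
    by rewrite /dual_coef; ring.
  under eq_integral do under eq_bigr do rewrite dE.
  apply: int_powR_sum_scale D0 _ _ (dual_test z) => // k.
  by rewrite /dual_coef !mulr_ge0 ?invr_ge0 ?fine_ge0.
have := strong_estimate_normalized S_inj S_ne S_lam mS fmu fnu bot_top cover s1 s1' ss'
  A0 Anull mf f0 fA a'0 test1 test2.
have DE t : (\sum_k A (top k) * (a k / D) * \1_(S (bot k)) t) `^ s =
    (D `^ s)^-1 * (\sum_k A (top k) * a k * \1_(S (bot k)) t) `^ s.
  under eq_bigr do rewrite mulrA; apply: powR_sum_scale => // k.
  exact: mulr_ge0.
under eq_integral do rewrite DE.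
rewrite ge0_intZ ?invr_ge0 ?powR_ge0//; [|exact: mE|by move=> t; exact: powR_ge0].
move=> h; have Ds0 : 0 < D `^ s by rewrite powR_gt0.
rewrite -[leLHS]mul1e -(@divff _ (D `^ s)) ?gt_eqF// EFinM -muleA [leRHS]muleCA.
by rewrite lee_wpmul2l// lee_fin ltW.
Qed.

(** With [La] the tested sum, [h = La ^ (s' - 1)] and [f] the [q]-th root of the
    maximal function of [h], the integral [Y] of [La ^ s'] equals the sum of the
    averages of [h] against the coefficients [a k nu (bot k)], which is at most
    the [nu]-integral of the sum [W] formed with the averages of [f].  As [W] lives on [S z], Young's
    inequality bounds the latter by a multiple of the integral of [W ^ s] plus a
    multiple of [nu (S z)].  The hypothesis and Doob's inequality bound the
    integral of [W ^ s] by a multiple of [Y]; the parameter [eta] is chosen such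
    that this contributes [Y / 2]. *)
Lemma dual_necessity (q M : R) : 0 < q -> 0 < M ->
  (forall f : T -> R, measurable_fun setT f -> (forall t, 0 <= f t) ->
    (\int[mu]_t (f t `^ (q * s))%:E < +oo)%E ->
    (\int[nu]_t ((\sum_k aver mu (S (top k)) f `^ q * a k * \1_(S (bot k)) t) `^ s)%:E
       <= M%:E * \int[mu]_t (f t `^ (q * s))%:E)%E) ->
  forall z, (\int[mu]_t ((\sum_(k | `[< S (top k) `<=` S z >])
      dual_coef mu nu S top bot a k * \1_(S (top k)) t) `^ s')%:E
      <= (2 * (2 * M * doob_const s) `^ (s' / s))%:E * nu (S z))%E.
Proof.
move=> q0 M0 bound z.
have s0 := lt_trans ltr01 s1; have s0' := lt_trans ltr01 s1'.
have ss'' : s'^-1 + s^-1 = 1 by rewrite addrC.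
set P := fun k => `[< S (top k) `<=` S z >].
set lam := dual_coef mu nu S top bot a.
have lam0 k : 0 <= lam k by rewrite /lam /dual_coef !mulr_ge0 ?invr_ge0 ?fine_ge0.
set La := fun t => \sum_(k | P k) lam k * \1_(S (top k)) t.
have La0 t : 0 <= La t by apply: sumr_ge0 => k _; exact: indicZ_ge0.
have mLa : measurable_fun setT La.
  by apply: measurable_sum_cond => k; exact: measurable_indicZ.
have fLa : (\int[mu]_t (La t `^ s')%:E < +oo)%E by exact: int_sum_indic_powR_lty.
pose h t := La t `^ (s' - 1).
have h0 t : 0 <= h t by exact: powR_ge0.
have mh : measurable_fun setT h by exact: measurable_pow.
have hE t : h t `^ s = La t `^ s' by rewrite /h -powRrM (conjugate_expE s1' ss'').
have fh : (\int[mu]_t (h t `^ s)%:E < +oo)%E by under eq_integral do rewrite hE.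
pose A x := aver mu (S x) h.
have A0 x : 0 <= A x by exact: aver_ge0.
have hA x : ((A x)%:E * mu (S x) = \int[mu]_t (h t * \1_(S x) t)%:E)%E.
  by apply: averE => //; exact: (int_indic_lty s1).
have [pf pfP] := stopping_map_exists S_ne S_lam (rounding \o A).
have doob : (\int[mu]_t (maxfun S A predT t `^ s)%:E <=
    (doob_const s)%:E * \int[mu]_t (La t `^ s')%:E)%E.
  apply: le_trans (doob_maximal_inequality S_inj S_lam A0 pfP mS fmu mh h0 hA s1 s1' ss') _.
  by under eq_integral do rewrite hE.
have D10 := doob_const_gt0 s1; move: (doob_const s) D10 doob => D1 D10 doob.
pose f t := maxfun S A predT t `^ q^-1.
have m0 t : 0 <= maxfun S A predT t by exact: maxfun_ge0.
have f0 t : 0 <= f t by exact: powR_ge0.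
have mf : measurable_fun setT f by apply: measurable_pow; exact: measurable_maxfun.
have fE t : f t `^ (q * s) = maxfun S A predT t `^ s.
  by rewrite /f -powRrM mulrA mulVf ?mul1r// gt_eqF.
have ff : (\int[mu]_t (f t `^ (q * s))%:E < +oo)%E.
  under eq_integral do rewrite fE; apply: le_lt_trans doob _.
  by apply: lte_mul_pinfty => //; rewrite lee_fin ltW.
(* On [S x] the function [f] is at least the [q]-th root of [A x]. *)
have fA x : A x <= aver mu (S x) f `^ q.
  have [x0|x0] := eqVneq (mu (S x)) 0.
    by rewrite /A aver_null// powR_ge0.
  have fin : (\int[mu]_t (f t * \1_(S x) t)%:E < +oo)%E.
    pose b := (\sum_(y : X) A y) `^ q^-1.
    apply: (@le_lt_trans _ _ (\int[mu]_t (b * \1_(S x) t)%:E)%E).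
      apply: ge0_le_int => [||t].
      - by apply: measurable_funM => //; exact: measurable_indic.
      - exact: measurable_indicZ.
      - rewrite indicZ_ge0//=; apply: ler_wpM2r; first by have /andP[] := indic01 R (S x) t.
        apply: ler_powR_base => //; first by rewrite invr_ge0 ltW.
        apply: maxfun_le => //; first exact: sumr_ge0.
        by move=> y _ _; rewrite (bigD1 y)//= lerDl sumr_ge0.
    rewrite int_indicZ ?powR_ge0//; rewrite lte_mul_pinfty// ?lee_fin ?powR_ge0//.
  have := averE mf f0 (mS x) (fmu x) fin.
  have fm : mu (S x) \is a fin_num by rewrite ge0_fin_numE.
  have : ((A x `^ q^-1)%:E * mu (S x) <= \int[mu]_t (f t * \1_(S x) t)%:E)%E.
    rewrite -int_indicZ ?powR_ge0//; apply: ge0_le_int => [||t].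
    - exact: measurable_indicZ.
    - by apply: measurable_funM => //; exact: measurable_indic.
    - rewrite indicZ_ge0 ?powR_ge0//=.
      have [xt|xt] := pselect (S x t); last by rewrite indic0// !mulr0.
      rewrite indic1// !mulr1; apply: ler_powR_base => //; first by rewrite invr_ge0 ltW.
      exact: le_maxfun.
  move=> + e; rewrite -e -(fineK fm) -!EFinM lee_fin ler_pM2r; last first.
    by rewrite fine_gt0// lt0e x0 measure_ge0/= -ge0_fin_numE.
  move=> /(ler_powR_base (ltW q0) (powR_ge0 _ _)).
  by rewrite -powRrM mulVf ?gt_eqF// powRr1.
pose W t := \sum_(k | P k) aver mu (S (top k)) f `^ q * a k * \1_(S (bot k)) t.
have cW0 k : 0 <= aver mu (S (top k)) f `^ q * a k by rewrite mulr_ge0 ?powR_ge0.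
have W0 t : 0 <= W t by apply: sumr_ge0 => k _; exact: indicZ_ge0.
have mW : measurable_fun setT W.
  by apply: measurable_sum_cond => k; exact: measurable_indicZ.
have Wz t : W t = W t * \1_(S z) t.
  have [zt|zt] := pselect (S z t); first by rewrite indic1// mulr1.
  rewrite indic0// mulr0; apply: big1 => k /asboolP kz.
  by rewrite indic0 ?mulr0// => /bot_top/kz.
have YW : (\int[mu]_t (La t `^ s')%:E <= \int[nu]_t (W t)%:E)%E.
  have -> : (\int[mu]_t (La t `^ s')%:E =
      \int[mu]_t (\sum_(k | P k) lam k * (h t * \1_(S (top k)) t))%:E)%E.
    apply: eq_integral => t _; congr _%:E.
    under eq_bigr do rewrite mulrCA; rewrite -mulr_sumr -/(La t) /h.
    have {1}-> : s' = (s' - 1) + 1 by rewrite subrK.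
    rewrite powRD ?powRr1//; last by rewrite subrK gt_eqF.
  rewrite ge0_int_sum; last 2 first.
  - move=> k; apply: measurable_funM => //.
    by apply: measurable_funM => //; exact: measurable_indic.
  - by move=> k t; rewrite mulr_ge0// indicZ_ge0.
  rewrite int_sum_indic//; rewrite -sumEFin; apply: lee_sum => k _.
  rewrite ge0_intZ//; last 2 first.
  - by apply: measurable_funM => //; exact: measurable_indic.
  - by move=> t; exact: indicZ_ge0.
  rewrite -hA -[X in (_ * (_ * X))%E]fineK ?ge0_fin_numE// -!EFinM lee_fin /lam /dual_coef.
  have [m00|m00] := eqVneq (mu (S (top k))) 0.
    by rewrite m00 /= !mulr0 !mulr_ge0 ?powR_ge0 ?fine_ge0.
  have fm0 : fine (mu (S (top k))) != 0 by rewrite fine_eq0 ?ge0_fin_numE.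
  rewrite [leLHS](_ : _ = A (top k) * (a k * fine (nu (S (bot k))))); last by field.
  by rewrite -[leRHS]mulrA ler_wpM2r ?mulr_ge0 ?fine_ge0.
have Wbound : (\int[nu]_t (W t `^ s)%:E <=
    (M * D1)%:E * \int[mu]_t (La t `^ s')%:E)%E.
  apply: (@le_trans _ _ (M%:E * \int[mu]_t (f t `^ (q * s))%:E)%E).
    apply: le_trans (bound f mf f0 ff).
    by apply: int_powR_sum_subset => //; exact: ltW.
  under eq_integral do rewrite fE.
  by rewrite EFinM -muleA lee_wpmul2l ?lee_fin ?(ltW M0).
pose eta := (2 * M * D1) `^ (- s^-1).
have B0 : 0 < 2 * M * D1 by rewrite mulr_gt0// mulr_gt0.
have eta0 : 0 < eta by rewrite powR_gt0.
have WY : (\int[nu]_t (W t)%:E <=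
    (eta `^ s)%:E * \int[nu]_t (W t `^ s)%:E + (eta^-1 `^ s')%:E * nu (S z))%E.
  rewrite -ge0_intZ ?powR_ge0//; [|exact: measurable_pow|by move=> t; exact: powR_ge0].
  rewrite -int_indicZ ?powR_ge0// -ge0_intD; last 4 first.
  - by apply: measurable_funM => //; exact: measurable_pow.
  - exact: measurable_indicZ.
  - by move=> t; rewrite mulr_ge0 ?powR_ge0.
  - by move=> t; rewrite indicZ_ge0 ?powR_ge0.
  apply: ge0_le_int => [||t] //.
    apply: measurable_funD; last exact: measurable_indicZ.
    by apply: measurable_funM => //; exact: measurable_pow.
  rewrite W0 /= Wz.
  have [zt|zt] := pselect (S z t); last first.
    by rewrite indic0// !mulr0 addr0 mulr_ge0 ?powR_ge0.
  rewrite indic1// !mulr1 -powRM ?(ltW eta0)//.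
  apply: (@le_trans _ _ ((eta * W t) * eta^-1)).
    by rewrite mulrAC divff ?mul1r// gt_eqF.
  apply: young_le => //; first by rewrite mulr_ge0// ltW.
  by rewrite invr_ge0 ltW.
have etas : eta `^ s = (2 * (M * D1))^-1.
  rewrite /eta -powRrM mulNr mulVf ?gt_eqF// powRN powRr1 ?(ltW B0)//.
  by rewrite mulrA.
have etas' : eta^-1 `^ s' = (2 * M * D1) `^ (s' / s).
  by rewrite /eta powRN invrK -powRrM [s' / s]mulrC.
have Y_fin : (\int[mu]_t (La t `^ s')%:E)%E \is a fin_num.
  by rewrite ge0_fin_numE// int_ge0// => t; exact: powR_ge0.
have nu_fin : nu (S z) \is a fin_num by rewrite ge0_fin_numE.
have {YW WY Wbound} : (\int[mu]_t (La t `^ s')%:E <=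
    (eta `^ s)%:E * ((M * D1)%:E * \int[mu]_t (La t `^ s')%:E) +
    (eta^-1 `^ s')%:E * nu (S z))%E.
  apply: le_trans YW (le_trans WY _); apply: leeD => //.
  by apply: lee_wpmul2l => //; rewrite lee_fin powR_ge0.
rewrite etas etas' -(fineK Y_fin) -(fineK nu_fin).
have MD0 : 0 < M * D1 by rewrite mulr_gt0.
move: (M * D1) (fine _) (fine _) (powR _ _) MD0 => b n Y e b0.
rewrite -(EFinM b) -(EFinM _ (b * Y)) -(EFinM e) -EFinD -(EFinM (2 * e)) !lee_fin.
rewrite invfM mulrA -[2^-1 * _ * _]mulrA mulVf ?gt_eqF// mulr1 => Yle; lra.
Qed.

End ScaledStrong.

(** * Intervals of an atomic filtration *)

Section Filtration.
Variables (d : measure_display) (T : measurableType d) (R : realType).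
Variables (S L : int -> set (set T)).
Hypothesis SL : atomic_filtration S L.
Implicit Types (I J Z : set T) (m n : int).

Lemma filtration_mono m n : (m <= n)%R -> S m `<=` S n.
Proof.
move=> mn; have -> : n = m + `|n - m|%N by rewrite gez0_abs ?subr_ge0//; ring.
elim: `|n - m|%N => [|k IH]; first by rewrite addr0.
apply: subset_trans IH _.
have -> : m + k.+1%:Z = m + k%:Z + 1 by rewrite intS; ring.
exact: (filtration_increasing SL).
Qed.

(** An atom of the coarser level is a union of atoms of the finer level. *)
Lemma atom_nested m n I J t : (m <= n)%R -> L m I -> L n J -> I t -> J t ->
  J `<=` I.
Proof.
move=> mn LI LJ It Jt.
have SI : S n I by apply: (filtration_mono mn); exact: (atoms_in_filtration SL).
have [F FL IE] := atoms_generate SL SI.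
move: (It); rewrite IE => -[K FK Kt].
have -> : J = K.
  by apply: (atoms_disjoint SL LJ (FL _ FK)); exists t.
by move=> u Ku; exists K.
Qed.

Lemma intervals_laminar I J t : intervals L I -> intervals L J ->
  I t -> J t -> I `<=` J \/ J `<=` I.
Proof.
move=> [m _ LI] [n _ LJ] It Jt; have [mn|/ltW nm] := leP m n.
  by right; exact: atom_nested LI LJ It Jt.
by left; exact: atom_nested LJ LI Jt It.
Qed.

Lemma interval_measurable I : intervals L I -> measurable I.
Proof.
move=> [n _ LI]; apply: (filtration_measurable SL (n := n)).
exact: (atoms_in_filtration SL).
Qed.

Lemma interval_nonempty I : intervals L I -> I !=set0.
Proof. by move=> [n _]; exact: (atoms_nonempty SL). Qed.

(** A finite supremum of a set of integers belongs to the set. *)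
Lemma rk_attained I n : intervals L I -> rk R L I = (n%:~R)%:E -> L n I.
Proof.
move=> [k _ LI] rkI.
have : ((n%:~R - 2^-1)%:E < rk R L I)%E by rewrite rkI lte_fin; lra.
move=> /ereal_sup_gt[_ [m LmI <-]]; rewrite lte_fin => nm.
have mn : (m <= n)%R.
  by rewrite -(ler_int R) -lee_fin -rkI; apply: ereal_sup_ubound; exists m.
have nm' : (n < m + 1)%R by rewrite -(ltr_int R) rmorphD /=; lra.
by have -> : n = m by lia.
Qed.

Lemma ch_sub I J : intervals L I -> ch R L I J -> intervals L J /\ J `<=` I.
Proof.
by move=> LI [[_ ->]//|[n [_ LJ JI]]]; split => //; exists (n + 1).
Qed.

(** No interval lies strictly between a child and its parent: an interval [Z] that
    contains the child [J] is either an atom of a level up to that of [I], and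
    then contains [I], or an atom of a finer level, and then is contained in
    [J]. *)
Lemma ch_cover I J Z : intervals L I -> ch R L I J -> intervals L Z ->
  J `<=` Z -> Z <> J -> I `<=` Z.
Proof.
move=> LI [[_ ->]//|[n [rkI LJ JI]]] [m _ LZ] JZ nZJ.
have [t Jt] := atoms_nonempty SL LJ.
have [mn|nm] := leP m n.
  exact: (atom_nested mn LZ (rk_attained LI rkI) (JZ _ Jt) (JI _ Jt)).
have nm1 : (n + 1 <= m)%R by lia.
exfalso; apply: nZJ; apply/seteqP; split => //.
exact: (atom_nested nm1 LJ LZ Jt (JZ _ Jt)).
Qed.

Lemma ch_disjoint I J J' t : ch R L I J -> ch R L I J' -> J t -> J' t -> J = J'.
Proof.
move=> [[rkI ->]|[n [rkI LJ _]]] [[rkI' ->]|[n' [rkI' LJ' _]]] Jt Jt' //.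
- by rewrite rkI in rkI'.
- by rewrite rkI in rkI'.
move: LJ'; have -> : n' = n.
  by move: rkI'; rewrite rkI => -[/eqP]; rewrite eqr_int => /eqP.
by move=> LJ'; apply: (atoms_disjoint SL LJ LJ'); exists t.
Qed.

Lemma countable_intervals : countable (intervals L).
Proof. by apply: bigcup_countable => // n _; exact: (atoms_countable SL). Qed.

Definition pairs : set (set T * set T) := [set k | intervals L k.1 /\ ch R L k.1 k.2].

Lemma pairsE : pairs = intervals L `*`` ch R L.
Proof. by apply/seteqP; split. Qed.

Lemma countable_pairs : countable pairs.
Proof.
apply: (@sub_countable _ _ _ (intervals L `*` intervals L)).
  by apply: subset_card_le => -[I J] [/= LI /(ch_sub LI)[]].
by apply: countableX; exact: countable_intervals.
Qed.

End Filtration.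

(** * Countable sums as limits of finite sums *)

Lemma ler_poweR_base (R : realType) (s : R) (x y : \bar R) : (0 <= s)%R ->
  (0 <= x)%E -> (x <= y)%E -> (x `^ s <= y `^ s)%E.
Proof.
move=> s0 x0 xy; apply: gt0_ler_poweR => //; rewrite in_itv /= leey andbT //.
exact: le_trans xy.
Qed.

Section Exhaustion.
Variables (R : realType) (K : choiceType).

Lemma countable_enumeration (D : set K) : countable D -> D !=set0 ->
  exists (P : pred nat) (e : nat -> K), set_bij [set n | P n] D e.
Proof.
move=> /countable_injP[f finj] [k0 Dk0].
pose P n := `[< exists2 k, D k & f k = n >].
pose e n := xget k0 [set k | D k /\ f k = n].
have eP n : P n -> D (e n) /\ f (e n) = n.
  move=> /asboolP[k Dk fk]; rewrite /e.
  by have := @xgetPex _ k0 [set k | D k /\ f k = n]; apply; exists k.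
exists P, e; split.
- by move=> n /eP[].
- move=> m n /set_mem Pm /set_mem Pn emn.
  by have [_ <-] := eP _ Pm; have [_ <-] := eP _ Pn; rewrite emn.
- move=> k Dk; have Pk : P (f k) by apply/asboolP; exists k.
  exists (f k) => //; have [De fe] := eP _ Pk.
  by apply: finj => //; rewrite inE.
Qed.

(** The exhaustion depends on [D] only, so it serves all points of a family of
    sums at the same time; this is what monotone convergence needs. *)
Lemma countable_exhaustion (D : set K) : countable D -> exists l : nat -> seq K,
  [/\ forall n, uniq (l n), forall n k, k \in l n -> D k &
    forall a : K -> R, (forall k, 0 <= a k) ->
      {homo (fun n => \sum_(k <- l n) a k) : m n / (m <= n)%N >-> m <= n} /\
      (\esum_(k in D) (a k)%:E =
        ereal_sup (range (fun n => (\sum_(k <- l n) a k)%:E)))%E].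
Proof.
move=> cD; have [D0|/set0P Dne] := eqVneq D set0.
  exists (fun=> [::]); split=> [//|//|a a0].
  split=> [m n _|]; first by rewrite !big_nil.
  rewrite D0 esum_set0.
  have -> : range (fun _ : nat => (\sum_(k <- [::]) a k)%:E) = [set 0%E].
    by apply/seteqP; split=> [_ [n _ <-]|_ ->]; [|exists 0%N]; rewrite ?big_nil.
  by rewrite ereal_sup1.
have [P [e [eD einj esurj]]] := countable_enumeration cD Dne.
exists (fun n => [seq e i | i <- iota 0 n & P i]); split.
- move=> n; rewrite map_inj_in_uniq ?filter_uniq ?iota_uniq// => i j.
  rewrite !mem_filter => /andP[Pi _] /andP[Pj _] eij.
  by apply: einj => //; rewrite inE.
- by move=> n k /mapP[i]; rewrite mem_filter => /andP[Pi _] ->; exact: eD.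
move=> a a0.
have sE n : \sum_(k <- [seq e i | i <- iota 0 n & P i]) a k =
    \sum_(0 <= i < n | P i) a (e i).
  by rewrite big_map big_filter /index_iota subn0.
have homo_s : {homo (fun n => \sum_(k <- [seq e i | i <- iota 0 n & P i]) a k) :
    m n / (m <= n)%N >-> m <= n}.
  move=> m n mn; rewrite !sE (big_cat_nat _ mn)//= lerDl.
  by apply: sumr_ge0.
split=> //.
rewrite (@reindex_esum _ _ _ _ _ e _ (And3 eD einj esurj)) -nneseries_esum; last first.
  by move=> n _; rewrite lee_fin.
have -> : (fun n => \sum_(0 <= i < n | P i) (a (e i))%:E)%E =
    (fun n => (\sum_(k <- [seq e i | i <- iota 0 n & P i]) a k)%:E).
  by apply/funext => n; rewrite sE sumEFin.
apply/cvg_lim => //; apply: ereal_nondecreasing_cvgn => m n mn.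
by rewrite lee_fin homo_s.
Qed.

End Exhaustion.

Section IntegralEsum.
Variables (d : measure_display) (T : measurableType d) (R : realType).
Variable om : {measure set T -> \bar R}.
Variables (K : choiceType) (D : set K) (c : K -> R) (E : K -> set T) (s : R).
Hypothesis cD : countable D.
Hypothesis c0 : forall k, 0 <= c k.
Hypothesis mE : forall k, D k -> measurable (E k).
Hypothesis s0 : 0 < s.

(** The paraproduct norm and both testing integrals are integrals of powers of
    such functions: with [E = snd] for the children and [E = fst] for the
    parents of the pairs. *)
Definition esumf t : \bar R := \esum_(k in D) (c k * \1_(E k) t)%:E.

Lemma measurable_seq_sum (l : seq K) : (forall k, k \in l -> D k) ->
  measurable_fun setT (fun t => \sum_(k <- l) c k * \1_(E k) t).
Proof.
elim: l => [_|k l IH lD].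
  by under eq_fun do rewrite big_nil; exact: measurable_cst.
under eq_fun do rewrite big_cons; apply: measurable_funD.
  by apply: measurable_indicZ; apply: mE; apply: lD; rewrite mem_head.
by apply: IH => j jl; apply: lD; rewrite inE jl orbT.
Qed.

(** The power commutes with the supremum of the partial sums because both the
    power and its inverse are monotone. *)
Lemma esumf_powR_lim : exists l : nat -> seq K,
  [/\ forall n, uniq (l n), forall n k, k \in l n -> D k,
    forall t, {homo (fun n => ((\sum_(k <- l n) c k * \1_(E k) t) `^ s)%:E) :
      m n / (m <= n)%N >-> (m <= n)%E} &
    forall t, (esumf t `^ s =
      limn (fun n => ((\sum_(k <- l n) c k * \1_(E k) t) `^ s)%:E))%E].
Proof.
have [l [lu lD lE]] := countable_exhaustion R cD.
exists l; have s00 := ltW s0.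
have sum0 t n : 0 <= \sum_(k <- l n) c k * \1_(E k) t.
  by apply: sumr_ge0 => k _; exact: indicZ_ge0.
have homo t : {homo (fun n => ((\sum_(k <- l n) c k * \1_(E k) t) `^ s)%:E) :
      m n / (m <= n)%N >-> (m <= n)%E}.
  move=> m n mn; rewrite lee_fin; apply: ler_powR_base => //.
  by have [+ _] := lE (fun k => c k * \1_(E k) t) (fun k => indicZ_ge0 _ _ (c0 k)); apply.
split=> // t.
have [_ eE] := lE (fun k => c k * \1_(E k) t) (fun k => indicZ_ge0 _ _ (c0 k)).
rewrite /esumf eE; symmetry; apply/cvg_lim => //.
have -> : (ereal_sup (range (fun n => (\sum_(k <- l n) c k * \1_(E k) t)%:E)) `^ s =
    ereal_sup (range (fun n => ((\sum_(k <- l n) c k * \1_(E k) t) `^ s)%:E)))%E.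
  apply/eqP; rewrite eq_le; apply/andP; split.
    set M := ereal_sup (range (fun n => (_ `^ s)%:E)).
    have M0 : (0 <= M)%E.
      apply: (@le_trans _ _ ((\sum_(k <- l 0%N) c k * \1_(E k) t) `^ s)%:E).
        by rewrite lee_fin powR_ge0.
      by apply: ereal_sup_ubound; exists 0%N.
    have -> : M = ((M `^ s^-1) `^ s)%E by rewrite -poweRrM mulVf ?gt_eqF// poweRe1.
    apply: ler_poweR_base => //.
      apply: (@le_trans _ _ (\sum_(k <- l 0%N) c k * \1_(E k) t)%:E).
        by rewrite lee_fin.
      by apply: ereal_sup_ubound; exists 0%N.
    apply: ge_ereal_sup => _ [n _ <-].
    have -> : ((\sum_(k <- l n) c k * \1_(E k) t)%:E =
        (((\sum_(k <- l n) c k * \1_(E k) t)%:E `^ s) `^ s^-1))%E.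
      by rewrite -poweRrM mulfV ?gt_eqF// poweRe1// lee_fin.
    apply: ler_poweR_base; [by rewrite invr_ge0|exact: poweR_ge0|].
    by apply: ereal_sup_ubound; exists n.
  apply: ge_ereal_sup => _ [n _ <-]; rewrite -poweR_EFin.
  apply: ler_poweR_base => //; first by rewrite lee_fin.
  by apply: ereal_sup_ubound; exists n.
exact: ereal_nondecreasing_cvgn.
Qed.

Lemma measurable_esumf_powR : measurable_fun setT (fun t => (esumf t `^ s)%E).
Proof.
have [l [lu lD lhomo lE]] := esumf_powR_lim.
apply: (emeasurable_fun_cvg (fun n t => ((\sum_(k <- l n) c k * \1_(E k) t) `^ s)%:E)).
  by move=> n; apply/measurable_EFinP/measurable_pow/measurable_seq_sum/lD.
move=> t _; rewrite lE; exact: ereal_nondecreasing_is_cvgn.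
Qed.

Lemma int_esumf_le (M : \bar R) :
  (forall l : seq K, uniq l -> (forall k, k \in l -> D k) ->
    (\int[om]_t ((\sum_(k <- l) c k * \1_(E k) t) `^ s)%:E <= M)%E) ->
  (\int[om]_t (esumf t `^ s) <= M)%E.
Proof.
move=> H; have [l [lu lD lhomo lE]] := esumf_powR_lim.
under eq_integral do rewrite lE.
have ml n : measurable_fun setT
    (fun t => ((\sum_(k <- l n) c k * \1_(E k) t) `^ s)%:E).
  by apply/measurable_EFinP/measurable_pow/measurable_seq_sum/lD.
rewrite (monotone_convergence om measurableT ml); last 2 first.
- by move=> n t _; rewrite lee_fin powR_ge0.
- by move=> t _; exact: lhomo.
apply: lime_le; last by apply: nearW => n; exact: H (lu n) (lD n).
apply: ereal_nondecreasing_is_cvgn => m n mn; apply: ge0_le_integral => //.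
- by move=> t _; rewrite lee_fin powR_ge0.
- by move=> t _; exact: lhomo.
Qed.

Lemma le_int_esumf (l : seq K) : uniq l -> (forall k, k \in l -> D k) ->
  (\int[om]_t ((\sum_(k <- l) c k * \1_(E k) t) `^ s)%:E <=
   \int[om]_t (esumf t `^ s))%E.
Proof.
move=> ul lD; apply: ge0_le_integral => //.
- by move=> t _; rewrite lee_fin powR_ge0.
- by apply/measurable_EFinP/measurable_pow/measurable_seq_sum.
- exact: measurable_esumf_powR.
move=> t _; rewrite -poweR_EFin; apply: ler_poweR_base; first exact: ltW.
  by rewrite lee_fin; apply: sumr_ge0 => k _; exact: indicZ_ge0.
rewrite /esumf; apply: ereal_sup_ubound; exists [set` l].
  by split; [exact: finite_seq|exact: lD].
by rewrite -fsbig_seq// sumEFin.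
Qed.

End IntegralEsum.

(** * Norm and testing integrals as sums over pairs *)

Lemma esumZ (R : realType) (K : choiceType) (D : set K) (c : R) (a : K -> R) :
  0 <= c -> (forall k, 0 <= a k) ->
  (c%:E * (\esum_(k in D) (a k)%:E) = \esum_(k in D) (c * a k)%:E)%E.
Proof.
move=> c0 a0; rewrite /esum -ereal_supZl//; last first.
  by apply/set0P; exists (\sum_(k \in set0) (a k)%:E)%E; exists set0 => //; split.
congr ereal_sup; apply/seteqP; split => [_ [_ [A [finA AD] <-] <-]|_ [A [finA AD] <-]].
  exists A; first by split.
  by rewrite !fsbig_finite//= !sumEFin -EFinM mulr_sumr.
exists (\sum_(k \in A) (a k)%:E)%E; first by exists A.
by rewrite !fsbig_finite//= !sumEFin -EFinM mulr_sumr.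
Qed.

Section Conversion.
Variables (d : measure_display) (T : measurableType d) (R : realType).
Variables mu nu : {measure set T -> \bar R}.
Variables (S L : int -> set (set T)) (beta : set T -> set T -> R) (q : R).
Hypothesis SL : atomic_filtration S L.
Hypothesis fmu : locally_finite L mu.
Hypothesis fnu : locally_finite L nu.
Hypothesis q0 : 0 < q.

Definition coef (k : set T * set T) : R := `|beta k.1 k.2| `^ q.

Definition pairs_in (J : set T) : set (set T * set T) :=
  [set k | pairs R L k /\ k.1 `<=` J].

Lemma coef_ge0 k : 0 <= coef k. Proof. exact: powR_ge0. Qed.

Lemma countable_pairs_in J : countable (pairs_in J).
Proof.
apply: (@sub_countable _ _ _ (pairs R L)); last exact: (countable_pairs R SL).
by apply: subset_card_le => k [].
Qed.

Lemma pairs_measurable k : pairs R L k -> measurable k.1 /\ measurable k.2.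
Proof.
move=> [L1 /(ch_sub L1)[L2 _]]; split; exact: (interval_measurable SL).
Qed.

(** At most one child contains [t]. *)
Lemma bfun_powE I t :
  ((`|bfun L beta I t| `^ q)%:E =
   \esum_(J in ch R L I) (coef (I, J) * \1_J t)%:E)%E.
Proof.
have [[J [chJ Jt]]|nJ] := pselect (exists J, ch R L I J /\ J t).
  have z J' : ch R L I J' -> J' <> J -> \1_J' t = 0 :> R.
    move=> chJ' ne; apply: indic0 => J't; apply: ne.
    exact: (ch_disjoint SL chJ' chJ J't Jt).
  have -> : bfun L beta I t = beta I J.
    rewrite /bfun -(fsbig_widen [set J]) ?fsbig_set1 ?indic1 ?mulr1//.
      by move=> _ ->.
    by move=> J' [chJ' ne]; rewrite /= z ?mulr0.
  rewrite (esumID [set J]); last first.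
    by move=> J' _; rewrite lee_fin indicZ_ge0// coef_ge0.
  have -> : ch R L I `&` [set J] = [set J].
    by apply/seteqP; split=> [J' []//|J' ->]; split.
  rewrite esum_set1 ?lee_fin ?indicZ_ge0 ?coef_ge0// esum1 ?adde0.
    by rewrite indic1// mulr1.
  by move=> J' [chJ' ne]; rewrite z// mulr0.
have z J' : ch R L I J' -> \1_J' t = 0 :> R.
  by move=> chJ'; apply: indic0 => J't; apply: nJ; exists J'.
rewrite /bfun fsbig1; last by move=> J' /z ->; rewrite mulr0.
by rewrite normr0 powR0 ?gt_eqF// esum1// => J' /z ->; rewrite mulr0.
Qed.

Lemma direct_testE (r : R) J : 0 < r ->
  (\int[nu]_(x in J) (\esum_(I in intervals_in L J)
       (`|bfun L beta I x| `^ q)%:E) `^ r =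
   \int[nu]_x (esumf (pairs_in J) coef snd x `^ r))%E.
Proof.
move=> r0; rewrite integral_mkcond; apply: eq_integral => t _.
rewrite patchE; case: ifPn => [_|/negP]; last first.
  rewrite inE => nJt; rewrite /esumf esum1 ?poweR0r ?gt_eqF//.
  move=> k [[Lk /(ch_sub Lk)[_ k21]] k1J]; rewrite indic0 ?mulr0//.
  by move=> /k21/k1J.
congr (_ `^ _)%E; under eq_esum do rewrite bfun_powE.
rewrite esum_esum; last by move=> I I' _ _; rewrite lee_fin indicZ_ge0// coef_ge0.
rewrite /esumf; have -> : pairs_in J = intervals_in L J `*`` ch R L.
  by apply/seteqP; split=> [k [[Lk chk] kJ]|k [[Lk kJ] chk]].
by apply: eq_esum => -[].
Qed.

Definition dcoef (k : set T * set T) : R :=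
  coef k * fine (nu k.2) / fine (mu k.1).

Lemma dcoef_ge0 k : 0 <= dcoef k.
Proof. by rewrite /dcoef !mulr_ge0 ?coef_ge0 ?invr_ge0 ?fine_ge0. Qed.

(** Both inequalities between the integral and the sum come from the finite case,
    through the description of [esumf] by finite partial sums with exponent
    [1]. *)
Lemma int_bfun I : intervals L I ->
  (\int[nu]_(x in I) (`|bfun L beta I x| `^ q)%:E =
   \esum_(J in ch R L I) (coef (I, J) * fine (nu J))%:E)%E.
Proof.
move=> LI; pose c J := coef (I, J).
have c0 J : 0 <= c J by exact: coef_ge0.
have cch : countable (ch R L I).
  apply: (@sub_countable _ _ _ (intervals L)); last exact: (countable_intervals SL).
  by apply: subset_card_le => J /(ch_sub LI)[].
have mch J : ch R L I J -> measurable J.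
  by move=> /(ch_sub LI)[LJ _]; exact: (interval_measurable SL).
have -> : (\int[nu]_(x in I) (`|bfun L beta I x| `^ q)%:E =
    \int[nu]_x (esumf (ch R L I) c id x `^ 1))%E.
  rewrite integral_mkcond; apply: eq_integral => t _.
  rewrite poweRe1; last by apply: esum_ge0 => J _; rewrite lee_fin indicZ_ge0.
  rewrite patchE; case: ifPn => [_|/negP]; first by rewrite bfun_powE.
  rewrite inE => nIt; rewrite /esumf esum1// => J /(ch_sub LI)[_ JI].
  by rewrite indic0 ?mulr0// => /JI.
have fin (l : seq (set T)) : uniq l -> (forall J, J \in l -> ch R L I J) ->
    (\int[nu]_t ((\sum_(J <- l) c J * \1_J t) `^ 1)%:E =
     \sum_(J <- l) (c J * fine (nu J))%:E)%E.
  move=> ul lch.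
  have -> : (\int[nu]_t ((\sum_(J <- l) c J * \1_J t) `^ 1)%:E =
      \int[nu]_t (\sum_(J <- l) (c J * \1_J t)%:E))%E.
    apply: eq_integral => t _; rewrite powRr1 ?sumEFin//.
    by apply: sumr_ge0 => J _; exact: indicZ_ge0.
  elim: l ul lch => [_ _|J l IH /= /andP[_ ul] lch].
    by rewrite big_nil; under eq_integral do rewrite big_nil; rewrite integral0.
  under eq_integral do rewrite big_cons.
  have chJ : ch R L I J by apply: lch; rewrite mem_head.
  have lch' J' : J' \in l -> ch R L I J' by move=> h; apply: lch; rewrite inE h orbT.
  rewrite ge0_integralD//; last 4 first.
  - by move=> t _; rewrite lee_fin indicZ_ge0.
  - by apply/measurable_EFinP/measurable_indicZ/mch.
  - by move=> t _; apply: sume_ge0 => J' _; rewrite lee_fin indicZ_ge0.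
  - under eq_fun do rewrite sumEFin; apply/measurable_EFinP.
    by apply: (@measurable_seq_sum _ _ _ _ (ch R L I) c id).
  rewrite big_cons IH// int_indicZ//; last exact: mch.
  congr (_ + _)%E; rewrite EFinM fineK// ge0_fin_numE//; apply: fnu.
  by have [] := ch_sub LI chJ.
apply/eqP; rewrite eq_le; apply/andP; split.
  apply: (int_esumf_le cch c0 mch) => // l ul lch; rewrite fin//.
  apply: ereal_sup_ubound; exists [set` l]; last by rewrite -fsbig_seq.
  by split; [exact: finite_seq|exact: lch].
apply: ge_ereal_sup => _ [A [finA AD] <-].
have [l0 Al0] := (finite_seqP A).1 finA.
have {l0 Al0} [l ul Al] : exists2 l, uniq l & A = [set` l].
  exists (undup l0); first exact: undup_uniq.
  by rewrite Al0; apply/seteqP; split=> J /=; rewrite mem_undup.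
have lch J : J \in l -> ch R L I J by move=> Jl; apply: AD; rewrite Al.
rewrite Al -fsbig_seq// -fin//.
exact: (le_int_esumf nu cch c0 mch).
Qed.

Lemma dual_testE (r' : R) J : 0 < r' ->
  (\int[mu]_(x in J) (\esum_(I in intervals_in L J)
       ((fine (nu I) / fine (mu I))%:E *
        cond_exp nu I (fun y => (`|bfun L beta I y| `^ q)%:E) x)) `^ r' =
   \int[mu]_x (esumf (pairs_in J) dcoef fst x `^ r'))%E.
Proof.
move=> r0; rewrite integral_mkcond; apply: eq_integral => t _.
rewrite patchE; case: ifPn => [_|/negP]; last first.
  rewrite inE => nJt; rewrite /esumf esum1 ?poweR0r ?gt_eqF//.
  by move=> k [_ k1J]; rewrite indic0 ?mulr0// => /k1J.
congr (_ `^ _)%E.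
have -> : (\esum_(I in intervals_in L J) ((fine (nu I) / fine (mu I))%:E *
        cond_exp nu I (fun y => (`|bfun L beta I y| `^ q)%:E) t) =
    \esum_(I in intervals_in L J) \esum_(I' in ch R L I)
      (dcoef (I, I') * \1_I t)%:E)%E.
  apply: eq_esum => I [LI IJ]; rewrite /cond_exp /avg int_bfun//.
  rewrite (_ : (\esum_(I' in ch R L I) (dcoef (I, I') * \1_I t)%:E)%E =
    (\1_I t / fine (mu I))%:E *
      (\esum_(I' in ch R L I) (coef (I, I') * fine (nu I'))%:E))%E; last first.
    rewrite esumZ.
    - by apply: eq_esum => I' _; congr _%:E; rewrite /dcoef /=; ring.
    - by rewrite mulr_ge0 ?invr_ge0 ?fine_ge0//; have /andP[] := indic01 R I t.
    - by move=> I'; rewrite mulr_ge0 ?coef_ge0 ?fine_ge0.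
  have [n0|n0] := eqVneq (fine (nu I)) 0.
    rewrite n0 mul0r mul0e esum1 ?mule0// => I' /(ch_sub LI)[LI' I'I].
    have nuI : nu I = 0%E.
      by apply/eqP; rewrite -fine_eq0 ?n0// ge0_fin_numE// fnu.
    suff -> : nu I' = 0%E by rewrite mulr0.
    apply/eqP; rewrite eq_le measure_ge0 andbT -nuI le_measure// ?inE.
      exact: (interval_measurable SL).
    exact: (interval_measurable SL).
  set E := (\esum_(_ in _) _)%E.
  rewrite [(_ * E * _)%E]muleAC muleA -!EFinM; congr (_%:E * _)%E.
  by rewrite mulrACA divff// mul1r mulrC.
rewrite esum_esum; last by move=> I I' _ _; rewrite lee_fin indicZ_ge0// dcoef_ge0.
rewrite /esumf; have -> : pairs_in J = intervals_in L J `*`` ch R L.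
  by apply/seteqP; split=> [k [[Lk chk] kJ]|k [[Lk kJ] chk]].
by apply: eq_esum => -[].
Qed.

Definition pcoef (f : T -> R) (k : set T * set T) : R :=
  `|aver mu k.1 f| `^ q * coef k.

Lemma pcoef_ge0 f k : 0 <= pcoef f k.
Proof. by rewrite /pcoef mulr_ge0 ?powR_ge0 ?coef_ge0. Qed.

Lemma seq_normE (p : R) (f : T -> R) : 0 < p ->
  (seq_norm nu L p q (paraproduct mu beta f) `^ p =
   \int[nu]_x (esumf (pairs R L) (pcoef f) snd x `^ (p / q)))%E.
Proof.
move=> p0; rewrite /seq_norm poweR_Lnorm ?gt_eqF//; apply: eq_integral => t _.
rewrite gee0_abs ?poweR_ge0// -poweRrM [(q^-1 * p)%R]mulrC; congr (_ `^ _)%E.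
rewrite esum_esum; last first.
  move=> I I' _ _; rewrite lee_fin indicZ_ge0// powR_ge0//.
rewrite /esumf pairsE; apply: eq_esum => -[I I'] _ /=; congr (_ * _)%:E.
by rewrite /pcoef /coef /paraproduct /aver normrM powRM.
Qed.

End Conversion.

(** * Finite families of intervals *)

Lemma tnth_in_tuple_mem (K : eqType) (l : seq K) (i : 'I_(size l)) :
  tnth (in_tuple l) i \in l.
Proof. exact: mem_tnth. Qed.

(** The sets become the elements of a finite type, without repetition, so that an
    interval that occurs in several pairs, or both as a parent and as a child, is
    counted once in the Carleson sums. *)
Lemma finite_family_of_sets (T : Type) (ns : seq (set T)) (l : seq (set T * set T)) :
  (forall k, k \in l -> k.1 \in ns /\ k.2 \in ns) ->
  exists (X : finType) (N : X -> set T) (top bot : 'I_(size l) -> X),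
    [/\ injective N, forall x, N x \in ns, forall I, I \in ns -> exists x, N x = I,
      forall i, N (top i) = (tnth (in_tuple l) i).1 &
      forall i, N (bot i) = (tnth (in_tuple l) i).2].
Proof.
move=> lns; exists (seq_sub ns), (@ssval _ ns).
have in1 i : (tnth (in_tuple l) i).1 \in ns by have [] := lns _ (tnth_in_tuple_mem i).
have in2 i : (tnth (in_tuple l) i).2 \in ns by have [] := lns _ (tnth_in_tuple_mem i).
exists (fun i => SeqSub (in1 i)), (fun i => SeqSub (in2 i)); split=> //.
- exact: val_inj.
- by move=> x; exact: ssvalP.
- by move=> I Ins; exists (SeqSub Ins).
Qed.

(** With [y] the average of [`|f|], Young's inequality gives the tangent bound
    [`|f| * y ^ (q - 1) <= `|f| ^ q / q + y ^ q / q'], where [q'] is the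
    conjugate exponent; it is averaged over [E]. *)
Lemma jensen_aver (d : measure_display) (T : measurableType d) (R : realType)
    (mu : {measure set T -> \bar R}) (E : set T) (f : T -> R) (q : R) :
  1 < q -> measurable_fun setT f -> measurable E -> (mu E < +oo)%E ->
  (\int[mu]_t (`|f t| `^ q * \1_E t)%:E < +oo)%E ->
  `|aver mu E f| `^ q <= aver mu E (fun t => `|f t| `^ q).
Proof.
move=> q1 mf mE fE ffin; have q0 := lt_trans ltr01 q1.
have [E0|E0] := eqVneq (mu E) 0%E.
  by rewrite !aver_null// normr0 powR0 ?gt_eqF.
have fm : mu E \is a fin_num by rewrite ge0_fin_numE.
have m0 : 0 < fine (mu E) by rewrite fine_gt0// lt0e E0 measure_ge0/= fE.
have mnf : measurable_fun setT (fun t => `|f t|) by exact: measurableT_comp.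
have mfq : measurable_fun setT (fun t => `|f t| `^ q) by exact: measurable_pow.
have fin1 : (\int[mu]_t (`|f t| * \1_E t)%:E < +oo)%E.
  apply: (@le_lt_trans _ _ (\int[mu]_t (`|f t| `^ q * \1_E t + \1_E t)%:E)%E).
    apply: ge0_le_int => [||t].
    - by apply: measurable_funM => //; exact: measurable_indic.
    - apply: measurable_funD; last exact: measurable_indic.
      by apply: measurable_funM => //; exact: measurable_indic.
    rewrite indicZ_ge0//=.
    have [Et|Et] := pselect (E t); last by rewrite !indic0// !mulr0 addr0.
    rewrite indic1// !mulr1; have [g1|/ltW g1] := leP `|f t| 1.
      by rewrite (le_trans g1)// lerDr powR_ge0.
    by rewrite -[leLHS]powRr1// (le_trans (ler_powR g1 (ltW q1)))// lerDl.
  rewrite ge0_intD.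
  - by rewrite integral_indic// setIT lte_add_pinfty.
  - by apply: measurable_funM => //; exact: measurable_indic.
  - exact: measurable_indic.
  - by move=> t; rewrite indicZ_ge0// powR_ge0.
  - by move=> t; have /andP[] := indic01 R E t.
set y := aver mu E (fun t => `|f t|).
have y0 : 0 <= y by exact: aver_ge0.
have yE : ((y)%:E * mu E = \int[mu]_t (`|f t| * \1_E t)%:E)%E by exact: averE.
have zE : ((aver mu E (fun t => `|f t| `^ q))%:E * mu E =
    \int[mu]_t (`|f t| `^ q * \1_E t)%:E)%E.
  by apply: averE => // t; exact: powR_ge0.
set z := aver _ _ _ in zE *.
have fy : `|aver mu E f| <= y.
  have absI : (`|\int[mu]_(t in E) (f t)%:E| <= \int[mu]_(t in E) `|f t|%:E)%E.
    by apply: le_abse_integral => //; exact/measurable_EFinP/measurable_funTS.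
  have absf : (\int[mu]_(t in E) `|f t|%:E)%E \is a fin_num.
    by rewrite integral_indicE ge0_fin_numE// int_ge0// => t; exact: indicZ_ge0.
  have If : (\int[mu]_(t in E) (f t)%:E)%E \is a fin_num.
    by rewrite fin_num_abs (le_lt_trans absI)// ltey_eq absf.
  rewrite /y /aver /avg /= -(fineK If) -(fineK absf) -!EFinM /= normrM.
  rewrite ger0_norm ?invr_ge0 ?(ltW m0)// ler_wpM2l ?invr_ge0 ?(ltW m0)//.
  by rewrite -lee_fin -abse_EFin !fineK.
apply: (@le_trans _ _ (y `^ q)); first by apply: ler_powR_base => //; exact: ltW.
pose q' := q / (q - 1).
have qm : 0 < q - 1 by rewrite subr_gt0.
have q'0 : 0 < q' by rewrite divr_gt0.
have qq' : q^-1 + q'^-1 = 1.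
  by rewrite /q'; field; rewrite !gt_eqF.
have : ((y `^ (q - 1))%:E * (y%:E * mu E) <=
    (q^-1 * z + q'^-1 * y `^ q)%:E * mu E)%E.
  rewrite yE EFinD ge0_muleDl ?lee_fin ?mulr_ge0 ?invr_ge0 ?powR_ge0 ?(ltW q0) ?(ltW q'0)//; last first.
    by apply: aver_ge0 => t; exact: powR_ge0.
  rewrite [(q^-1 * z)%:E]EFinM -muleA zE -ge0_intZ ?powR_ge0//; last first.
    by apply: measurable_funM => //; exact: measurable_indic.
  rewrite -ge0_intZ ?invr_ge0 ?(ltW q0)//; last first.
    by apply: measurable_funM => //; exact: measurable_indic.
  rewrite -int_indicZ ?mulr_ge0 ?invr_ge0 ?powR_ge0 ?(ltW q'0)//.
  rewrite -ge0_intD; last 4 first.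
  - apply: measurable_funM => //.
    by apply: measurable_funM => //; exact: measurable_indic.
  - exact: measurable_indicZ.
  - by move=> t; rewrite mulr_ge0 ?invr_ge0 ?(ltW q0)// indicZ_ge0 ?powR_ge0.
  - by move=> t; rewrite indicZ_ge0 ?mulr_ge0 ?invr_ge0 ?powR_ge0 ?(ltW q'0).
  apply: ge0_le_int => [||t].
  - apply: measurable_funM => //.
    by apply: measurable_funM => //; exact: measurable_indic.
  - apply: measurable_funD; last exact: measurable_indicZ.
    apply: measurable_funM => //.
    by apply: measurable_funM => //; exact: measurable_indic.
  rewrite mulr_ge0 ?powR_ge0 ?indicZ_ge0//=.
  have [Et|Et] := pselect (E t); last by rewrite !indic0// !mulr0 addr0.
  rewrite indic1// !mulr1 mulrC.
  have := conjugate_powR (normr_ge0 (f t)) (powR_ge0 y (q - 1)) q0 q'0 qq'.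
  rewrite -powRrM; have -> : (q - 1) * q' = q by rewrite /q'; field; rewrite gt_eqF.
  by rewrite mulrC [X in _ <= _ + X]mulrC [X in _ <= X + _]mulrC.
rewrite -(fineK fm) -!EFinM lee_fin mulrA ler_pM2r//.
have -> : y `^ (q - 1) * y = y `^ q.
  rewrite -{2}[y]powRr1// -powRD ?subrK//.
  by rewrite gt_eqF.
have -> : q'^-1 = 1 - q^-1 by rewrite -qq'; ring.
move=> h; have : q^-1 * y `^ q <= q^-1 * z by lra.
by rewrite ler_pM2l// invr_gt0.
Qed.

Section FiniteEstimates.
Variables (d : measure_display) (T : measurableType d) (R : realType).
Variables mu nu : {measure set T -> \bar R}.
Variables (S L : int -> set (set T)) (beta : set T -> set T -> R) (q r r' : R).
Hypothesis SL : atomic_filtration S L.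
Hypothesis fmu : locally_finite L mu.
Hypothesis fnu : locally_finite L nu.
Hypothesis q0 : 0 < q.
Hypothesis r1 : 1 < r.
Hypothesis r1' : 1 < r'.
Hypothesis rr' : r^-1 + r'^-1 = 1.

Notation a := (coef beta q).

Lemma sum_filter_tnth (l : seq (set T * set T)) (J : set T)
    (F : set T * set T -> R) :
  \sum_(i < size l | `[< (tnth (in_tuple l) i).1 `<=` J >]) F (tnth (in_tuple l) i)
  = \sum_(k <- [seq k <- l | `[< k.1 `<=` J >]]) F k.
Proof. by rewrite big_filter [RHS]big_tnth. Qed.

Lemma pairs_in_filter (l : seq (set T * set T)) (J : set T) :
  (forall k, k \in l -> pairs R L k) ->
  forall k, k \in [seq k <- l | `[< k.1 `<=` J >]] -> pairs_in R L J k.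
Proof.
move=> lp k; rewrite mem_filter => /andP[/asboolP kJ kl]; split=> //; exact: lp.
Qed.

Lemma finite_laminar_family (ns : seq (set T)) (l : seq (set T * set T)) :
  (forall k, k \in l -> pairs R L k) -> (forall I, I \in ns -> intervals L I) ->
  exists (X : finType) (N : X -> set T) (top bot : 'I_(size l) -> X),
    [/\ injective N, forall x, intervals L (N x), forall I, I \in ns -> exists x, N x = I,
      forall i, N (top i) = (tnth (in_tuple l) i).1 &
      forall i, N (bot i) = (tnth (in_tuple l) i).2].
Proof.
move=> lp nsL; pose ns' := ns ++ [seq k.1 | k <- l] ++ [seq k.2 | k <- l].
have [k kl|X [N [top [bot [Ninj Nns nsN topE botE]]]]] := @finite_family_of_sets T ns' l.
  by rewrite !mem_cat !map_f// !orbT.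
exists X, N, top, bot; split=> //.
  move=> x; have := Nns x; rewrite !mem_cat => /or3P[/nsL//||] /mapP[k kl ->].
    by have [] := lp _ kl.
  by have [L1 /(ch_sub L1)[]] := lp _ kl.
by move=> I Ins; apply: nsN; rewrite mem_cat Ins.
Qed.

Lemma strong_estimate_pairs (D : R) (l : seq (set T * set T)) (h : T -> R) :
  uniq l -> (forall k, k \in l -> pairs R L k) -> 0 < D ->
  (forall J, intervals L J ->
    (\int[nu]_x (esumf (pairs_in R L J) a snd x `^ r) <= (D `^ r)%:E * mu J)%E) ->
  (forall J, intervals L J ->
    (\int[mu]_x (esumf (pairs_in R L J) (dcoef mu nu beta q) fst x `^ r')
      <= (D `^ r')%:E * nu J)%E) ->
  measurable_fun setT h -> (forall t, 0 <= h t) ->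
  (\int[mu]_t (h t `^ r)%:E < +oo)%E ->
  (\int[nu]_t ((\sum_(k <- l) aver mu k.1 h * a k * \1_(k.2) t) `^ r)%:E <=
    (strong_const r r')%:E * ((D `^ r)%:E * \int[mu]_t (h t `^ r)%:E))%E.
Proof.
move=> ul lp D0 test dual mh h0 fh.
have [//|X [N [top [bot [Ninj NL _ topE botE]]]]] := @finite_laminar_family [::] l lp.
have r0 := lt_trans ltr01 r1; have r0' := lt_trans ltr01 r1'.
have mN x : measurable (N x) by exact: (interval_measurable SL).
pose ai i := a (tnth (in_tuple l) i).
have ai0 i : 0 <= ai i by exact: coef_ge0.
pose A x := aver mu (N x) h.
have lpi i : pairs R L (tnth (in_tuple l) i) by exact/lp/tnth_in_tuple_mem.
have NE : (\int[nu]_t ((\sum_(k <- l) aver mu k.1 h * a k * \1_(k.2) t) `^ r)%:E =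
    \int[nu]_t ((\sum_i A (top i) * ai i * \1_(N (bot i)) t) `^ r)%:E)%E.
  apply: eq_integral => t _; rewrite big_tnth; congr (_ `^ _)%:E.
  by apply: eq_bigr => i _; rewrite /A topE botE.
have Nne x : N x !=set0 by exact: (interval_nonempty SL).
have Nlam x y t : N x t -> N y t -> N x `<=` N y \/ N y `<=` N x.
  exact: (intervals_laminar SL).
have fmuN x : (mu (N x) < +oo)%E by exact: fmu.
have fnuN x : (nu (N x) < +oo)%E by exact: fnu.
have Nbt i : N (bot i) `<=` N (top i).
  by rewrite topE botE; have [L1 /(ch_sub L1)[]] := lpi i.
have Ncover i z : N (bot i) `<=` N z -> z <> bot i -> N (top i) `<=` N z.
  rewrite topE botE => Nz nz; have [L1 c1] := lpi i.
  apply: (ch_cover SL L1 c1 (NL z) Nz) => e; apply: nz; apply: Ninj.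
  by rewrite botE.
rewrite NE; apply: (strong_estimate Ninj Nne Nlam mN fmuN fnuN Nbt r1 r1' rr' ai0
  Ncover _ _ mh h0 _ D0).
- by move=> x; exact: aver_ge0.
- by move=> x; exact: aver_null.
- move=> x; apply: (averE mh h0 (mN x) (fmuN x)).
  exact: (int_indic_lty r1 mh h0 fh (mN x) (fmuN x)).
- move=> z; apply: le_trans (test _ (NL z)).
  under eq_integral do under eq_bigr do rewrite botE.
  under eq_integral do under eq_bigl do rewrite topE.
  under eq_integral do rewrite (sum_filter_tnth l (N z) (fun k => a k * \1_(k.2) _)).
  apply: le_int_esumf.
  - exact: (countable_pairs_in _ SL).
  - by move=> k; exact: coef_ge0.
  - by move=> k [/(pairs_measurable SL)[]].
  - exact: r0.
  - exact: filter_uniq.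
  - exact: pairs_in_filter.
- move=> z; apply: le_trans (dual _ (NL z)).
  have dE i : dual_coef mu nu N top bot ai i = dcoef mu nu beta q (tnth (in_tuple l) i).
    by rewrite /dual_coef topE botE.
  under eq_integral do under eq_bigr do rewrite dE topE.
  under eq_integral do under eq_bigl do rewrite topE.
  under eq_integral do
    rewrite (sum_filter_tnth l (N z) (fun k => dcoef mu nu beta q k * \1_(k.1) _)).
  apply: le_int_esumf.
  - exact: (countable_pairs_in _ SL).
  - by move=> k; exact: dcoef_ge0.
  - by move=> k [/(pairs_measurable SL)[]].
  - exact: r0'.
  - exact: filter_uniq.
  - exact: pairs_in_filter.
Qed.

(** The interval [J] is added to the family even if it is not an endpoint of a
    pair in [l], since the testing inequality is read on it. *)
Lemma dual_necessity_pairs (M : R) (l : seq (set T * set T)) (J : set T) :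
  0 < M -> intervals L J -> uniq l -> (forall k, k \in l -> pairs_in R L J k) ->
  (forall f : T -> R, measurable_fun setT f -> (forall t, 0 <= f t) ->
    (\int[mu]_t (f t `^ (q * r))%:E < +oo)%E ->
    (\int[nu]_t ((\sum_(k <- l) pcoef mu beta q f k * \1_(k.2) t) `^ r)%:E
       <= M%:E * \int[mu]_t (f t `^ (q * r))%:E)%E) ->
  (\int[mu]_t ((\sum_(k <- l) dcoef mu nu beta q k * \1_(k.1) t) `^ r')%:E
      <= (2 * (2 * M * doob_const r) `^ (r' / r))%:E * nu J)%E.
Proof.
move=> M0 LJ ul lJ bound.
have lp k : k \in l -> pairs R L k by move=> /lJ[].
have [I|X [N [top [bot [Ninj NL nsN topE botE]]]]] := @finite_laminar_family [:: J] l lp.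
  by rewrite inE => /eqP ->.
have [z zJ] := nsN J (mem_head _ _).
have mN x : measurable (N x) by exact: (interval_measurable SL).
pose ai i := a (tnth (in_tuple l) i).
have lpi i : pairs R L (tnth (in_tuple l) i) by exact/lp/tnth_in_tuple_mem.
have := @dual_necessity _ _ _ mu nu X _ N top bot.
have -> : (\int[mu]_t ((\sum_(k <- l) dcoef mu nu beta q k * \1_(k.1) t) `^ r')%:E =
    \int[mu]_t ((\sum_(i | `[< N (top i) `<=` N z >])
      dual_coef mu nu N top bot ai i * \1_(N (top i)) t) `^ r')%:E)%E.
  apply: eq_integral => t _; rewrite big_tnth; congr (_ `^ _)%:E.
  apply: eq_big => i; last by rewrite /dual_coef topE botE.
  symmetry; apply/asboolP; rewrite topE zJ.
  by have [] := lJ _ (tnth_in_tuple_mem i).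
move=> nec; rewrite -zJ; apply: (nec _ _ _ _ _ _ _ r r' _ _ _ ai _ q) => //.
- by move=> x; exact: (interval_nonempty SL).
- by move=> x y t; exact: (intervals_laminar SL).
- by move=> x; exact: fmu.
- by move=> x; exact: fnu.
- by move=> i; rewrite topE botE; have [L1 /(ch_sub L1)[]] := lpi i.
- by move=> i; exact: coef_ge0.
move=> f mf f0 ff; apply: le_trans (bound f mf f0 ff).
rewrite le_eqVlt; apply/orP; left; apply/eqP.
apply: eq_integral => t _; rewrite [in RHS]big_tnth; congr (_ `^ _)%:E.
apply: eq_bigr => i _; rewrite topE botE /pcoef ger0_norm//.
exact: aver_ge0.
Qed.

End FiniteEstimates.

(** * The two implications *)

Section Equivalence.
Variables (d : measure_display) (T : measurableType d) (R : realType).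
Variables mu nu : {measure set T -> \bar R}.
Variables (S L : int -> set (set T)) (beta : set T -> set T -> R) (p q r r' : R).
Hypothesis SL : atomic_filtration S L.
Hypothesis fmu : locally_finite L mu.
Hypothesis fnu : locally_finite L nu.
Hypothesis q1 : 1 < q.
Hypothesis r1 : 1 < r.
Hypothesis r1' : 1 < r'.
Hypothesis rr' : r^-1 + r'^-1 = 1.
Hypothesis pE : p = q * r.

Let q0 : 0 < q. Proof. exact: lt_trans q1. Qed.
Let r0 : 0 < r. Proof. exact: lt_trans r1. Qed.
Let r0' : 0 < r'. Proof. exact: lt_trans r1'. Qed.
Let p0 : 0 < p. Proof. by rewrite pE mulr_gt0. Qed.
Let pqE : p / q = r. Proof. by rewrite pE mulrAC divff ?mul1r ?gt_eqF. Qed.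

Lemma Lnorm_powE (f : T -> R) :
  ('N[mu]_(p%:E)[EFin \o f] `^ p = \int[mu]_t (`|f t| `^ p)%:E)%E.
Proof. by rewrite poweR_Lnorm ?gt_eqF. Qed.

Lemma mem_LfunP (f : T -> R) : f \in Lfun mu p%:E <->
  measurable_fun setT f /\ (\int[mu]_t (`|f t| `^ p)%:E < +oo)%E.
Proof.
split=> [fL|[mf ff]].
  split; first by have := sub_Lfun_mfun fL; rewrite inE.
  have := sub_Lfun_finLfun fL; rewrite inE /finite_norm /= => fN.
  by rewrite -Lnorm_powE poweR_lty.
apply/andP; split; rewrite inE //= /finite_norm.
rewrite -[X in (X < _)%E]poweRe1 ?Lnorm_ge0// -(@mulfV _ p) ?gt_eqF// poweRrM.
by rewrite poweR_lty// Lnorm_powE.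
Qed.

(** The common scale [D] normalizes both testing constants; the norm bound is
    homogeneous of degree [1 / q] in it. *)
Lemma testing_sufficient (b bs D : R) : 0 <= b -> 0 <= bs -> 0 < D ->
  b `^ q <= D -> bs <= D ->
  direct_testing mu nu L beta p q b -> dual_testing mu nu L beta q r' bs ->
  paraproduct_bound mu nu L beta p q (strong_const r r' `^ p^-1 * D `^ q^-1).
Proof.
move=> b0 bs0 D0 bD bsD test dual f /mem_LfunP[mf ff].
have C0 := strong_const_gt0 r1 r1'.
rewrite (seq_normE mu nu L beta q f p0) pqE Lnorm_powE.
rewrite powRM ?powR_ge0// -!powRrM mulVf ?gt_eqF// powRr1 ?(ltW C0)//.
rewrite [(q^-1 * p)%R]mulrC pqE.
pose h t := `|f t| `^ q.
have h0 t : 0 <= h t by exact: powR_ge0.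
have mh : measurable_fun setT h by apply: measurable_pow; exact: measurableT_comp.
have hE t : h t `^ r = `|f t| `^ p by rewrite /h -powRrM pE.
have fh : (\int[mu]_t (h t `^ r)%:E < +oo)%E by under eq_integral do rewrite hE.
apply: int_esumf_le => //.
- exact: countable_pairs SL.
- by move=> k; exact: pcoef_ge0.
- by move=> k /(pairs_measurable SL)[].
move=> l ul lp.
have Dtest J : intervals L J ->
    (\int[nu]_x (esumf (pairs_in R L J) (coef beta q) snd x `^ r) <= (D `^ r)%:E * mu J)%E.
  move=> LJ; rewrite -(direct_testE _ _ SL)// -pqE; apply: le_trans (test J LJ) _.
  rewrite lee_wpmul2r// lee_fin [in leRHS]pqE pE powRrM.
  by apply: ler_powR_base => //; rewrite ?powR_ge0 ?ltW.
have Ddual J : intervals L J ->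
    (\int[mu]_x (esumf (pairs_in R L J) (dcoef mu nu beta q) fst x `^ r')
      <= (D `^ r')%:E * nu J)%E.
  move=> LJ; rewrite -(dual_testE _ _ SL)//; apply: le_trans (dual J LJ) _.
  rewrite lee_wpmul2r// lee_fin; apply: ler_powR_base => //; exact: ltW.
have := strong_estimate_pairs SL fmu fnu r1 r1' rr' ul lp D0 Dtest Ddual mh h0 fh.
under [in X in (_ <= X)%E -> _]eq_integral do rewrite hE.
rewrite muleA -EFinM; apply: le_trans.
have mseq (c : set T * set T -> R) :
    measurable_fun setT (fun t => (\sum_(k <- l) c k * \1_(k.2) t) `^ r).
  apply: measurable_pow; apply: (@measurable_seq_sum _ _ _ _ (pairs R L) c snd) => //.
  by move=> k /(pairs_measurable SL)[].
apply: ge0_le_int => [||t]; [exact: mseq|exact: mseq|].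
rewrite powR_ge0 /=; apply: ler_powR_base; first exact: ltW.
  by apply: sumr_ge0 => k _; rewrite indicZ_ge0 ?pcoef_ge0.
rewrite big_seq [leRHS]big_seq; apply: ler_sum => k kl.
have [mk1 mk2] := pairs_measurable SL (lp _ kl).
apply: ler_wpM2r; first by have /andP[] := indic01 R k.2 t.
apply: ler_wpM2r; first exact: coef_ge0.
apply: jensen_aver => //.
  by apply: fmu; have [] := lp _ kl.
apply: (int_indic_lty r1) => //.
by apply: fmu; have [] := lp _ kl.
Qed.

(** The indicator of [J] has average [1] over every interval inside [J] that is not
    [mu]-null.  The pairs whose parent is [mu]-null contribute nothing
    [nu]-almost everywhere. *)
Lemma direct_testing_necessary (a : R) : no_invisible_coefficient mu nu L beta ->
  paraproduct_bound mu nu L beta p q a -> direct_testing mu nu L beta p q a.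
Proof.
move=> inv bound J LJ; rewrite pqE (direct_testE _ _ SL)//.
have mJ := interval_measurable SL LJ.
pose f t : R := \1_J t.
have fE t : `|f t| `^ p = \1_J t.
  rewrite /f; have [Jt|Jt] := pselect (J t).
    by rewrite indic1// normr1 powR1.
  by rewrite indic0// normr0 powR0 ?gt_eqF.
have If : (\int[mu]_t (`|f t| `^ p)%:E = mu J)%E.
  by under eq_integral do rewrite fE; rewrite integral_indic// setIT.
have fL : f \in Lfun mu p%:E.
  apply/mem_LfunP; split; first exact: measurable_indic.
  by rewrite If; exact: fmu.
have := bound f fL; rewrite Lnorm_powE If (seq_normE mu nu L beta q f p0) pqE.
apply: le_trans; apply: int_esumf_le => //.
- exact: (countable_pairs_in _ SL).
- by move=> k; exact: coef_ge0.
- by move=> k [/(pairs_measurable SL)[]].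
move=> l ul lJ.
have lp k : k \in l -> pairs R L k by move=> /lJ[].
have mk k : pairs R L k -> measurable k.2 by move=> /(pairs_measurable SL)[].
apply: (@le_trans _ _ (\int[nu]_t
    ((\sum_(k <- l) pcoef mu beta q f k * \1_(k.2) t) `^ r)%:E)%E); last first.
  apply: le_int_esumf => //; first exact: (countable_pairs R SL).
  by move=> k; exact: pcoef_ge0.
have one k : pairs_in R L J k ->
    {ae nu, forall t, coef beta q k * \1_(k.2) t = pcoef mu beta q f k * \1_(k.2) t}.
  move=> [[L1 ch1] k1J].
  have mk1 := interval_measurable SL L1.
  have [n0|n0] := eqVneq (nu k.2) 0%E.
    exists k.2; split=> //; first exact: mk.
    move=> t /= ne; apply: contrapT => nk; apply: ne.
    by rewrite indic0// !mulr0.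
  have [m0|m0] := eqVneq (mu k.1) 0%E.
    have b0 : beta k.1 k.2 = 0 by exact: inv.
    by apply: aeW => t; rewrite /pcoef /coef b0 normr0 powR0 ?gt_eqF// mulr0.
  apply: aeW => t; rewrite /pcoef.
  have -> : aver mu k.1 f = 1.
    have fm : mu k.1 \is a fin_num by rewrite ge0_fin_numE// fmu.
    rewrite /aver /avg integral_indic// setIC.
    rewrite (setIidl k1J) -(fineK fm) -EFinM /= mulVf//.
    by rewrite fine_eq0.
  by rewrite normr1 powR1 mul1r.
have all (l' : seq (set T * set T)) : (forall k, k \in l' -> pairs_in R L J k) ->
    {ae nu, forall t, \sum_(k <- l') coef beta q k * \1_(k.2) t =
      \sum_(k <- l') pcoef mu beta q f k * \1_(k.2) t}.
  elim: l' => [_|k l' IH lJ'].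
    by apply: aeW => t; rewrite !big_nil.
  have h1 := one k (lJ' _ (mem_head _ _)).
  have h2 : {ae nu, forall t, \sum_(k <- l') coef beta q k * \1_(k.2) t =
      \sum_(k <- l') pcoef mu beta q f k * \1_(k.2) t}.
    by apply: IH => j jl; apply: lJ'; rewrite inE jl orbT.
  by apply: filterS2 h1 h2 => t e1 e2; rewrite !big_cons e1 e2.
have mseq (c : set T * set T -> R) :
    measurable_fun setT (fun t => ((\sum_(k <- l) c k * \1_(k.2) t) `^ r)%:E).
  apply/measurable_EFinP/measurable_pow.
  exact: (@measurable_seq_sum _ _ _ _ (pairs R L) c snd).
rewrite le_eqVlt; apply/orP; left; apply/eqP.
apply: ge0_ae_eq_integral => //.
- by move=> t _; rewrite lee_fin powR_ge0.
- by move=> t _; rewrite lee_fin powR_ge0.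
by apply: filterS (all l lJ) => t e _; rewrite e.
Qed.

Definition dual_const : R := 2 `^ r'^-1 * (2 * doob_const r) `^ r^-1.

Lemma dual_const_gt0 : 0 < dual_const.
Proof.
have D0 := doob_const_gt0 r1; rewrite /dual_const.
by move: (doob_const r) D0 => D D0; rewrite mulr_gt0 ?powR_gt0// mulr_gt0.
Qed.

Lemma dual_testing_necessary (a : R) : 0 < a ->
  paraproduct_bound mu nu L beta p q a ->
  dual_testing mu nu L beta q r' (dual_const * a `^ q).
Proof.
move=> a0 bound J LJ; rewrite (dual_testE _ _ SL)//.
have D0 := doob_const_gt0 r1.
have ap0 : 0 < a `^ p by rewrite powR_gt0.
have -> : (dual_const * a `^ q) `^ r' =
    2 * (2 * a `^ p * doob_const r) `^ (r' / r).
  rewrite /dual_const; move: (doob_const r) D0 => D D0.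
  rewrite !powRM ?powR_ge0 ?mulr_ge0 ?(ltW D0) ?powR_ge0//.
  rewrite -!powRrM mulVf ?gt_eqF// powRr1// [r^-1 * r']mulrC.
  have -> : p * (r' / r) = q * r' by rewrite pE; field; rewrite gt_eqF.
  by ring.
apply: int_esumf_le => //.
- exact: (countable_pairs_in _ SL).
- by move=> k; exact: dcoef_ge0.
- by move=> k [/(pairs_measurable SL)[]].
move=> l ul lJ.
have lp k : k \in l -> pairs R L k by move=> /lJ[].
apply: (dual_necessity_pairs SL fmu fnu q0 r1 r1' rr' ap0 LJ ul lJ).
move=> f mf f0 ff; rewrite -pE.
have fE t : `|f t| = f t by rewrite ger0_norm.
have fL : f \in Lfun mu p%:E.
  apply/mem_LfunP; split=> //; under eq_integral do rewrite fE.
  by rewrite pE.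
have := bound f fL; rewrite Lnorm_powE (seq_normE mu nu L beta q f p0) pqE.
under [in X in (_ <= X)%E -> _]eq_integral do rewrite fE.
apply: le_trans; apply: le_int_esumf => //.
- exact: (countable_pairs R SL).
- by move=> k; exact: pcoef_ge0.
- by move=> k /(pairs_measurable SL)[].
Qed.

End Equivalence.

(** * Best constants *)

Lemma best_constant_ge0 (R : realType) (P : R -> Prop) : (0 <= best_constant P)%E.
Proof. by apply: le_ereal_inf_tmp => _ [a [a0 _] <-]; rewrite lee_fin. Qed.

Lemma best_constant_le (R : realType) (P : R -> Prop) a : 0 <= a -> P a ->
  (best_constant P <= a%:E)%E.
Proof. by move=> a0 Pa; apply: ereal_inf_lbound; exists a. Qed.

Lemma best_constant_lt (R : realType) (P : R -> Prop) (x : \bar R) :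
  (best_constant P < x)%E -> exists b, [/\ 0 <= b, P b & (b%:E < x)%E].
Proof. by move=> /ereal_inf_lt[_ [b [b0 Pb] <-] bx]; exists b. Qed.

(** The infima need not be attained, so the comparison is made with admissible
    constants slightly above them.  For the upper bound a number [M] above both
    best constants provides the common scale [D = M ^ q]. *)
Lemma compare_best_constants (R : realType) (PA PB PS : R -> Prop) (q k C : R) :
  0 < q -> 0 < k -> 0 < C ->
  (forall a a', 0 <= a -> a <= a' -> PA a -> PA a') ->
  (forall a, PA a -> PB a) ->
  (forall a, 0 < a -> PA a -> PS (k * a `^ q)) ->
  (forall b bs D, 0 <= b -> 0 <= bs -> 0 < D -> b `^ q <= D -> bs <= D ->
    PB b -> PS bs -> PA (C * D `^ q^-1)) ->
  ((exists2 a : R, 0 <= a & PA a) <->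
   (exists b bs : R, [/\ 0 <= b, 0 <= bs, PB b & PS bs])) /\
  (Order.max (best_constant PB) ((k `^ (- q^-1))%:E * best_constant PS `^ q^-1)
     <= best_constant PA)%E /\
  (best_constant PA <=
     C%:E * Order.max (best_constant PB) (best_constant PS `^ q^-1))%E.
Proof.
move=> q0 k0 C0 mono AB AS BSA; have iq0 : 0 <= q^-1 by rewrite invr_ge0 ltW.
have powK x : 0 <= x -> (x `^ q) `^ q^-1 = x.
  by move=> x0; rewrite -powRrM divff ?gt_eqF// powRr1.
split; [split=> [[a a0 Pa]|[b [bs [b0 bs0 Pb Pbs]]]]|split].
- have a1 : 0 < a + 1 by rewrite ltr_wpDl.
  exists a, (k * (a + 1) `^ q); split; rewrite ?mulr_ge0 ?powR_ge0 ?(ltW k0)//.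
    exact: AB.
  by apply: AS => //; apply: mono Pa => //; rewrite lerDl.
- exists (C * (b `^ q + bs + 1) `^ q^-1); first by rewrite mulr_ge0 ?powR_ge0 ?ltW.
  have bq0 : 0 <= b `^ q by exact: powR_ge0.
  by apply: (BSA b bs) => //; lra.
- rewrite ge_max; apply/andP; split.
    apply: le_ereal_inf_tmp => _ [a [a0 Pa] <-].
    by apply: best_constant_le => //; exact: AB.
  apply: le_ereal_inf_tmp => _ [a [a0 Pa] <-]; apply/lee_addgt0Pr => e e0.
  have ae0 : 0 < a + e by rewrite ltr_wpDl.
  have ka0 : 0 <= k * (a + e) `^ q by rewrite mulr_ge0 ?powR_ge0 ?ltW.
  have : (best_constant PS <= (k * (a + e) `^ q)%:E)%E.
    apply: best_constant_le => //; apply: AS => //.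
    by apply: mono Pa => //; rewrite lerDl ltW.
  move=> /(ler_poweR_base iq0 (best_constant_ge0 _)).
  rewrite poweR_EFin powRM ?powR_ge0 ?(ltW k0)// powK ?(ltW ae0)// => le1.
  have kq0 : 0 <= k `^ (- q^-1) by exact: powR_ge0.
  have := @lee_wpmul2l _ (k `^ (- q^-1))%:E _ _ _ le1; rewrite lee_fin => /(_ kq0).
  rewrite -EFinM mulrA powRN mulVf ?mul1r ?EFinD//.
  by rewrite gt_eqF// powR_gt0.
have m0 : (0 <= Order.max (best_constant PB) (best_constant PS `^ q^-1))%E.
  by rewrite le_max best_constant_ge0.
have Bm : (best_constant PB <=
    Order.max (best_constant PB) (best_constant PS `^ q^-1))%E.
  by rewrite le_max lexx.
have Sm : (best_constant PS `^ q^-1 <=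
    Order.max (best_constant PB) (best_constant PS `^ q^-1))%E.
  by rewrite le_max lexx orbT.
move: (Order.max _ _) m0 Bm Sm => [m||//] m0 Bm Sm; last first.
  by rewrite gt0_muley ?leey// lte_fin.
apply/lee_addgt0Pr => e e0; rewrite lee_fin in m0.
pose M := m + e / C.
have eC : 0 < e / C by rewrite divr_gt0.
have mM : m < M by rewrite ltrDl.
have M0 : 0 < M by rewrite (le_lt_trans m0).
have [b [b0 Pb]] : exists b, [/\ 0 <= b, PB b & (b%:E < M%:E)%E].
  by apply: best_constant_lt; rewrite (le_lt_trans Bm).
rewrite lte_fin => bM.
have [bs [bs0 Pbs]] : exists b, [/\ 0 <= b, PS b & (b%:E < (M `^ q)%:E)%E].
  apply: best_constant_lt; rewrite ltNge; apply/negP => MS.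
  have := ler_poweR_base iq0 _ MS; rewrite lee_fin powR_ge0 => /(_ isT).
  rewrite poweR_EFin powK ?(ltW M0)// => MS'.
  by have := le_trans MS' Sm; rewrite lee_fin leNgt mM.
rewrite lte_fin => bsM.
have -> : (C%:E * m%:E + e%:E)%E = (C * (M `^ q) `^ q^-1)%:E.
  rewrite powK ?(ltW M0)// -EFinM -EFinD; congr _%:E.
  by rewrite /M; field; rewrite gt_eqF.
apply: best_constant_le; first by rewrite mulr_ge0 ?powR_ge0 ?ltW.
apply: (BSA b bs) => //; rewrite ?powR_gt0// ?(ltW bsM)//.
by apply: ler_powR_base => //; exact: ltW.
Qed.

Theorem theorem1p12 (R : realType) (p q r r' : R)
  (hq : 1 < q) (hqp : q < p) (hr : r = p / q) (hr' : r^-1 + r'^-1 = 1) :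
  exists c C : R, [/\ 0 < c, 0 < C &
    forall (d : measure_display) (T : measurableType d)
      (mu nu : {measure set T -> \bar R})
      (S L : int -> set (set T)) (beta : set T -> set T -> R),
      sigma_finite [set: T] mu ->
      atomic_filtration S L ->
      locally_finite L mu ->
      locally_finite L nu ->
      no_invisible_coefficient mu nu L beta ->
      let Pi_bound := paraproduct_bound mu nu L beta p q in
      let test := direct_testing mu nu L beta p q in
      let dual_test := dual_testing mu nu L beta q r' in
      let A := best_constant Pi_bound in
      let B := best_constant test in
      let Bs := best_constant dual_test in
      ((exists2 a : R, 0 <= a & Pi_bound a) <->
       (exists b bs : R, [/\ 0 <= b, 0 <= bs, test b & dual_test bs])) /\
      (Order.max B (c%:E * Bs `^ q^-1) <= A)%E /\
      (A <= C%:E * Order.max B (Bs `^ q^-1))%E].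
Proof.
have q0 : 0 < q by exact: lt_trans hq.
have r1 : 1 < r by rewrite hr ltr_pdivlMr// mul1r.
have ir : 0 < r^-1 < 1 by rewrite invr_gt0 invf_lt1 ?(lt_trans ltr01 r1)// r1.
have r1' : 1 < r'.
  have /andP[ir0 ir1] := ir.
  have i0 : 0 < r'^-1 by lra.
  have r0' : 0 < r' by rewrite -invr_gt0.
  by rewrite -(invf_lt1 r0'); lra.
have pE : p = q * r by rewrite hr mulrCA divff ?mulr1// gt_eqF.
have k0 := dual_const_gt0 r' r1; have C0 := strong_const_gt0 r1 r1'.
exists (dual_const r r' `^ (- q^-1)), (strong_const r r' `^ p^-1).
split; [exact: powR_gt0|exact: powR_gt0|].
move=> d T mu nu S L beta _ SL fmu fnu inv.
apply: compare_best_constants => //; first exact: powR_gt0.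
- move=> a a' a0 aa' bound f fL; apply: le_trans (bound f fL) _.
  rewrite lee_wpmul2r ?poweR_ge0// lee_fin; apply: ler_powR_base => //.
  by rewrite pE mulr_ge0 ?ltW// (lt_trans ltr01 r1).
- by move=> a; exact: (direct_testing_necessary SL fmu hq r1 pE inv).
- by move=> a; exact: (dual_testing_necessary SL fmu fnu hq r1 r1' hr' pE).
- by move=> b bs D b0 bs0 D0; exact: (testing_sufficient SL fmu fnu hq r1 r1' hr' pE).
Qed.
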